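(* Let $n$ and $r$ be positive integers. For all positive integers $j$ and $k$, and all subsets $O, C \subseteq [n]$, $$\operatorname{NCN}_{j,k}^{O,C}(n,r) = \operatorname{NCN}_{k,j}^{O,C}(n,r),$$ where $\operatorname{NCN}_{j,k}^{O,C}(n,r)$ denotes the number of $r$-coloured permutations $\Sigma$ of $[n]$ with $\operatorname{cr}(\Sigma) < j$, $\operatorname{ne}(\Sigma) < k$, $\mathcal{O}(\Sigma) = O$ and $\mathcal{C}(\Sigma) = C$.
   Context: Write $[n]=\{1,\dots,n\}$. A permutation $S$ of $[n]$ is a bijection $\sigma:[n]\to[n]$. Arc diagram: $S$ is drawn on vertices $1,\dots,n$ placed in order on a horizontal line, with exactly one arc for each $i\in[n]$, joining $i$ and $\sigma(i)$. The arc is an upper arc if $\sigma(i)\ge i$ (so a fixed point gives an upper loop) and a lower arc if $\sigma(i)<i$. Record each arc as a pair (left endpoint, right endpoint): an upper arc is the pair $(i,\sigma(i))$ with $i\le\sigma(i)$, and a lower arc is the pair $(\sigma(i),i)$ with $\sigma(i)<i$. Let $\operatorname{Arc}(S)$ be the set of all $n$ arcs (upper and lower arcs are regarded as distinct even if they have the same endpoints). $r$-coloured permutation: a pair $\Sigma=(S,\phi)$, where $S$ is a permutation of $[n]$ and $\phi:\operatorname{Arc}(S)\to[r]$ is an arbitrary map (arc colouring). Crossings and nestings: a set of $k$ arcs $(i_1,j_1),\dots,(i_k,j_k)$ is - a $k$-crossing if $i_1<i_2<\dots<i_k<j_1<j_2<\dots<j_k$; - a $k$-nesting if $i_1<i_2<\dots<i_k<j_k<j_{k-1}<\dots<j_1$;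 - an enhanced $k$-crossing if $i_1<i_2<\dots<i_k\le j_1<j_2<\dots<j_k$; - an enhanced $k$-nesting if $i_1<i_2<\dots<i_k\le j_k<j_{k-1}<\dots<j_1$. For permutations, the enhanced notions are used for upper arcs and the non-enhanced notions for lower arcs. Thus $\Sigma$ is said to have a $k$-crossing (resp. $k$-nesting) if there are $k$ upper arcs all of the same colour forming an enhanced $k$-crossing (resp. enhanced $k$-nesting), or $k$ lower arcs all of the same colour forming a $k$-crossing (resp. $k$-nesting). Define $\operatorname{cr}(\Sigma)$ (resp. $\operatorname{ne}(\Sigma)$) as the maximum integer $k$ such that $\Sigma$ has a $k$-crossing (resp. $k$-nesting). Openers and closers: a vertex $i\in[n]$ is an opener of $S$ if $\sigma(i)>i$ and $\sigma^{-1}(i)>i$, and a closer of $S$ if $\sigma(i)<i$ and $\sigma^{-1}(i)<i$. For $\Sigma=(S,\phi)$, $\mathcal{O}(\Sigma)$ and $\mathcal{C}(\Sigma)$ denote the set of openers and the set of closers of the uncoloured permutation $S$, respectively. *)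

(* Defs.v *)
(* MathComp world. *)
From mathcomp Require Import all_boot all_fingroup.
Set Implicit Arguments.
Unset Strict Implicit.
Unset Printing Implicit Defensive.

(* The vertices 1, ..., n are represented by 'I_n, i.e. shifted to 0, ..., n-1;
   only their relative order matters. *)

(* (b, (l, r)) is the arc with left endpoint l and right endpoint r; it is an
   upper arc iff b, so that an upper and a lower arc with the same endpoints
   are different. *)
Definition arc (n : nat) := (bool * ('I_n * 'I_n))%type.

Definition is_upper n (a : arc n) : bool := a.1.
Definition arc_left n (a : arc n) : nat := a.2.1.
Definition arc_right n (a : arc n) : nat := a.2.2.

Definition arc_of n (s : 'S_n) (i : 'I_n) : arc n :=
  if i <= s i then (true, (i, s i)) else (false, (s i, i)).

Definition Arcs n (s : 'S_n) : {set arc n} := [set arc_of s i | i : 'I_n].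

Definition arc_colouring n r (s : 'S_n) : finType :=
  {ffun {a : arc n | a \in Arcs s} -> 'I_r}.

Definition coloured_perm n r : finType := {s : 'S_n & arc_colouring r s}.

Definition uncoloured n r (S : coloured_perm n r) : 'S_n := tag S.

Definition permArc n r (S : coloured_perm n r) : finType :=
  {a : arc n | a \in Arcs (uncoloured S)}.

Definition colour n r (S : coloured_perm n r) : permArc S -> 'I_r := tagged S.

(* In the next four definitions t lists arcs (i_1,j_1), ..., (i_k,j_k) in the
   order of their indices. The defaults 0 of last and head are used only if t
   is empty. *)
Definition is_crossing n (t : seq (arc n)) : bool :=
  let I := map (@arc_left n) t in let J := map (@arc_right n) t in
  [&& sorted ltn I, last 0 I < head 0 J & sorted ltn J].

Definition is_nesting n (t : seq (arc n)) : bool :=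
  let I := map (@arc_left n) t in let J := rev (map (@arc_right n) t) in
  [&& sorted ltn I, last 0 I < head 0 J & sorted ltn J].

Definition is_enhanced_crossing n (t : seq (arc n)) : bool :=
  let I := map (@arc_left n) t in let J := map (@arc_right n) t in
  [&& sorted ltn I, last 0 I <= head 0 J & sorted ltn J].

Definition is_enhanced_nesting n (t : seq (arc n)) : bool :=
  let I := map (@arc_left n) t in let J := rev (map (@arc_right n) t) in
  [&& sorted ltn I, last 0 I <= head 0 J & sorted ltn J].

Definition monochromatic n r (S : coloured_perm n r) (t : seq (permArc S)) :=
  [exists c : 'I_r, all (fun a => colour a == c) t].

Definition all_upper n (t : seq (arc n)) : bool := all (@is_upper n) t.
Definition all_lower n (t : seq (arc n)) : bool :=
  all (fun a => ~~ is_upper a) t.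

Definition has_crossing n r (S : coloured_perm n r) (k : nat) : bool :=
  [exists t : k.-tuple (permArc S),
    let u := map val t in
    monochromatic t &&
    (all_upper u && is_enhanced_crossing u || all_lower u && is_crossing u)].

Definition has_nesting n r (S : coloured_perm n r) (k : nat) : bool :=
  [exists t : k.-tuple (permArc S),
    let u := map val t in
    monochromatic t &&
    (all_upper u && is_enhanced_nesting u || all_lower u && is_nesting u)].

Lemma sorted_left_size n (t : seq (arc n)) :
  sorted ltn (map (@arc_left n) t) -> size t <= n.
Proof.
move=> st; rewrite -(size_map (@arc_left n)).
rewrite -[leqRHS](size_iota 0); apply: uniq_leq_size.
  by apply: sorted_uniq st; [exact: ltn_trans | exact: ltnn].
by move=> _ /mapP[a _ ->]; rewrite mem_iota /= /arc_left.
Qed.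

(* The two bounds below show that the maxima in cr and ne range over all k. *)
Lemma has_crossing_leq n r (S : coloured_perm n r) k :
  has_crossing S k -> k <= n.
Proof.
case/existsP=> t /= /andP[_ H]; rewrite -(size_tuple t) -(size_map val).
by apply: sorted_left_size; case/orP: H => /andP[_ /and3P[]].
Qed.

Lemma has_nesting_leq n r (S : coloured_perm n r) k :
  has_nesting S k -> k <= n.
Proof.
case/existsP=> t /= /andP[_ H]; rewrite -(size_tuple t) -(size_map val).
by apply: sorted_left_size; case/orP: H => /andP[_ /and3P[]].
Qed.

Definition cr n r (S : coloured_perm n r) : nat :=
  \max_(k < n.+1 | has_crossing S k) k.

Definition ne n r (S : coloured_perm n r) : nat :=
  \max_(k < n.+1 | has_nesting S k) k.

Definition openers n (s : 'S_n) : {set 'I_n} :=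
  [set i : 'I_n | (s i > i) && ((s^-1)%g i > i)].

Definition closers n (s : 'S_n) : {set 'I_n} :=
  [set i : 'I_n | (s i < i) && ((s^-1)%g i < i)].

Definition NCN (n r j k : nat) (O C : {set 'I_n}) : nat :=
  #|[set S : coloured_perm n r | [&& cr S < j, ne S < k,
      openers (uncoloured S) == O & closers (uncoloured S) == C]]|.

(* Main.v *)
Require Import Defs.
From mathcomp Require Import all_boot all_fingroup.
From mathcomp Require Import zify.

(** Crossings and nestings only involve arcs of one colour on one side of the
line, so a coloured permutation is cut into 2r layers, one for each side and
colour.  A layer is a partial matching, stored as the function sending the
right endpoint of each arc to its left endpoint.  Given, for each layer, the
set L of left endpoints and the set R of right endpoints, the layers can be
chosen independently; whether they fit together into a permutation, and what
its openers and closers are, depends on these sets only ([NCN_sum]).  Hence it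
is enough to exchange the bounds on crossings and nestings in a single layer
with prescribed L and R ([layer_count_sym]).

For one layer this is the theorem of Chen, Deng, Du, Stanley and Yan, and the
proof is theirs.  Read the vertices from right to left and keep the word of
partners: each closer appends its partner to the word, and each opener, which
is then the largest letter still in the word, is deleted from it.  At each
moment the arcs above a fixed point of the line are the letters of the word, a
crossing is a decreasing subsequence and a nesting an increasing one.  Let P be
the Robinson-Schensted insertion tableau of the word.  By Schensted's theorem
its number of rows and its number of columns are the lengths of the longest
decreasing and increasing subsequences ([schensted_rows],
[schensted_columns]).  Appending a letter adds a box to the shape of P, and
each way of adding a box arises from exactly one letter and one earlier tableau
([sum_insertions]); deleting the largest letter removes a box
([sum_remove_last]).  So the layers correspond to closed walks in Young's
lattice from the empty diagram, with the steps up and down prescribed by L and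
R, and the bounds on crossings and nestings bound the numbers of rows and
columns along the walk.  Transposing all diagrams exchanges the two bounds
([walk_count_transpose]).

Upper and lower arcs differ only in the order of the two events at a vertex.
From right to left, an enhanced layer (b = true) first closes and then opens,
so that loops occur and an arc ending at i meets one starting at i; an ordinary
layer first opens and then closes.  In both cases the conditions at vertex i
become conditions on letters smaller than i + b.

Standard tableaux are encoded by lattice words: the tableau is the word whose
letter at position p is the row, counted from 1, of the entry p, or 0 if p is
not an entry.  Increasing rows and columns then say that in each initial
segment every letter c > 0 occurs at least as often as c + 1, and Schensted's
bumping becomes one scan of the word. *)

Set Implicit Arguments.
Unset Strict Implicit.
Unset Printing Implicit Defensive.

(** * Row insertion on lattice words *)

(** Words are stored in reverse, with the last position at the head, because
the largest entry is the one that is deleted and because both directions of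
insertion then are structural recursions. *)
Fixpoint letter (u : seq nat) (p : nat) : nat :=
  if u is y :: v then if p == size v then y else letter v p else 0.

(** Schensted insertion of x, as a scan of the word from position x to the right.
The carry c is the row of the entry that was displaced last: a letter equal
to c at a later position is the smallest entry of row c exceeding the one that
has just entered this row, so it is bumped to row c + 1.  Starting from c = 0
at the empty position x puts x in row 1.  The final carry is the row of the new
box. *)
Fixpoint ins_carry (x : nat) (u : seq nat) : seq nat * nat :=
  if u is y :: v then
    let: (w, c) := ins_carry x v in
    if (x <= size v) && (y == c) then (c.+1 :: w, c.+1) else (y :: w, c)
  else ([::], 0).

Definition ins x u := (ins_carry x u).1.
Definition carry x u := (ins_carry x u).2.

(** Reverse bumping out of row c: scanning from the right, the last entry of row
c was pushed there from row c - 1, and so on until an entry leaves row 1. *)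
Fixpoint uninsert (c : nat) (u : seq nat) : seq nat :=
  if u is y :: v then
    if (0 < c) && (y == c) then c.-1 :: uninsert c.-1 v else y :: uninsert c v
  else [::].

(** Each initial segment has at least as many letters c as c + 1, for c > 0; this
is checked where a letter is read. *)
Fixpoint lattice (u : seq nat) : bool :=
  if u is y :: v then
    ((y <= 1) || (count_mem y v < count_mem y.-1 v)) && lattice v
  else true.

Lemma ins_cons x y u :
  ins x (y :: u) =
  (if (x <= size u) && (y == carry x u) then (carry x u).+1 else y) :: ins x u.
Proof. by rewrite /ins /carry /=; case: ins_carry => w c /=; case: ifP. Qed.

Lemma carry_cons x y u :
  carry x (y :: u) =
  if (x <= size u) && (y == carry x u) then (carry x u).+1 else carry x u.
Proof. by rewrite /carry /=; case: ins_carry => w c /=; case: ifP. Qed.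

Lemma size_ins x u : size (ins x u) = size u.
Proof. by elim: u => //= y u IH; rewrite ins_cons /= IH. Qed.

Lemma ins_out x u : size u <= x -> ins x u = u /\ carry x u = 0.
Proof.
elim: u => //= y u IH lt_ux; have [|iu cu] := IH; first lia.
by rewrite ins_cons carry_cons leqNgt lt_ux /= iu.
Qed.

Lemma letter_out u p : size u <= p -> letter u p = 0.
Proof. by elim: u => //= y u IH up; rewrite IH ?gtn_eqF //; lia. Qed.

Lemma carry_gt0 x u : x < size u -> letter u x = 0 -> 0 < carry x u.
Proof.
elim: u => //= y u IH xu; rewrite carry_cons.
case: eqP => [-> ->|ne ux]; last first.
  have := IH _ ux; case: ifP => // _ H; apply: H; lia.
by have [_ ->] := ins_out (leqnn (size u)); rewrite leqnn.
Qed.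

Lemma letter_ins_new x u :
  x < size u -> letter u x = 0 -> letter (ins x u) x = 1.
Proof.
elim: u => //= y u IH xu; rewrite ins_cons /= size_ins.
case: eqP => [-> ->|ne ux]; last by apply: IH => //; lia.
by have [_ ->] := ins_out (leqnn (size u)); rewrite leqnn.
Qed.

(** The carry is positive beyond position x, so bumping never empties or fills
another position. *)
Lemma letter_ins_eq0 x u p :
  letter u x = 0 -> p != x -> (letter (ins x u) p == 0) = (letter u p == 0).
Proof.
move=> ux px; elim: u ux => //= y u IH; rewrite ins_cons /= size_ins.
case: (ltngtP x (size u)) => [xu|xu|xu] ux.
- case: (p == size u); last exact: IH.
  by have := carry_gt0 xu ux; rewrite /=; case: (y =P _) => [->|] //=; lia.
- by case: (p == size u); last by apply: IH; rewrite letter_out //; lia.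
- rewrite -xu (negPf px); by have [|-> _] := @ins_out x u; first lia.
Qed.

Lemma count_ins x u d : x < size u -> letter u x = 0 -> 0 < d ->
  count_mem d (ins x u) = count_mem d u + (d == carry x u).
Proof.
move=> + + d0; elim: u => //= y u IH xu; rewrite ins_cons carry_cons /=.
case: eqP => [-> ->|ne ux].
  have [-> ->] := ins_out (leqnn (size u)); rewrite leqnn /= !(eq_sym _ d); lia.
have xu' : x < size u by lia.
rewrite IH // (ltnW xu') /=; have := carry_gt0 xu' ux.
by case: (y =P _) => [->|] /=; rewrite !(eq_sym _ d); lia.
Qed.

Lemma lattice_count u c : lattice u -> 0 < c -> count_mem c.+1 u <= count_mem c u.
Proof.
move=> + c0; elim: u => //= y u IH /andP[/orP[y1|yu] /IH].
  by case: (y == c); move: y1; lia.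
case: (y =P c.+1) yu => [->|] /=; lia.
Qed.

(** The second conclusion says that the final carry is an addable corner of the
shape; it is what makes the induction work.  After a bump from c to c + 1 it
holds because the letter c just read makes row c longer than row c + 1 in the
old word. *)
Lemma lattice_ins x u : letter u x = 0 -> lattice u ->
  lattice (ins x u) /\
  ((carry x u <= 1) || (count_mem (carry x u) u < count_mem (carry x u).-1 u)).
Proof.
elim: u => //= y u IH ux /andP[yu lu]; rewrite ins_cons carry_cons /=.
case: (ltngtP x (size u)) ux => xu ux /=.
- have [l1 cu] := IH ux lu; rewrite l1 andbT.
  have c0 := carry_gt0 xu ux.
  set c := carry x u in cu c0 *.
  have E d : 0 < d -> count_mem d (ins x u) = count_mem d u + (d == c).
    exact: count_ins.
  have [yc|yc] /= := eqVneq y c.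
    have := lattice_count lu c0; rewrite yc !E // eqxx.
    have -> : (c.+1 == c) = false by lia.
    have -> : (c == c.+1) = false by lia.
    by move=> le; rewrite addn0 addn1 add0n add1n !ltnS le !orbT.
  split.
    move: yu; case: (leqP y 1) => //= y1 yu.
    by rewrite !E ?(negPf yc) ?addn0; [apply: leq_trans yu (leq_addr _ _)|lia|lia].
  move: cu; case: (leqP c 1) => //= c1 cu.
  by rewrite (negPf yc) (leq_trans cu) ?leq_addl.
- have [-> ->] := ins_out (ltnW xu); by rewrite yu lu.
- rewrite xu; have [-> ->] := ins_out (leqnn (size u)).
  by rewrite ux eqxx /= lu.
Qed.

Lemma uninsert0 u : uninsert 0 u = u.
Proof. by elim: u => //= y u ->. Qed.

Lemma insK x u : letter u x = 0 -> uninsert (carry x u) (ins x u) = u.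
Proof.
elim: u => //= y u IH ux; rewrite ins_cons carry_cons /=.
case: (ltngtP x (size u)) ux => xu ux /=.
- have c0 := carry_gt0 xu ux; have [->|yc] /= := eqVneq; first by rewrite eqxx IH.
  by rewrite c0 (negPf yc) IH.
- by have [-> ->] := ins_out (ltnW xu); rewrite uninsert0.
- rewrite xu; have [-> ->] := ins_out (leqnn (size u)).
  by rewrite ux eqxx /= uninsert0.
Qed.

Lemma size_uninsert c u : size (uninsert c u) = size u.
Proof. by elim: u c => //= y u IH c; case: ifP => /= _; rewrite IH. Qed.

(** Insertion is surjective onto lattice words with a removable corner in row c.
The corner condition is inherited by the shorter initial segments with the
current value of the carry, which ensures that the scan reaches carry 0 before
the word ends. *)
Lemma uninsertP c v : lattice v -> 0 < c -> count_mem c.+1 v < count_mem c v ->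
  exists x, [/\ x < size v, letter (uninsert c v) x = 0, lattice (uninsert c v),
    ins x (uninsert c v) = v & carry x (uninsert c v) = c].
Proof.
elim: v c => //= y v IH c /andP[yv lv] c0 cv; rewrite c0 /=.
have lc := lattice_count lv c0.
have [yc|yc] := eqVneq y c; last first.
  have /(IH c lv c0) [x [xv ux lu iu cu]] :
    count_mem c.+1 v < count_mem c v
    by move: cv; rewrite (negPf yc); apply: leq_ltn_trans; apply: leq_addl.
  exists x; split; rewrite /= ?size_uninsert ?ins_cons ?carry_cons ?iu ?cu
    ?(negPf yc) ?andbF //; [by lia|by case: eqP => // e; lia|].
  rewrite lu andbT; case: (leqP y 1) yv => //= y1.
  have e d : 0 < d -> count_mem d v = count_mem d (uninsert c v) + (d == c).
    by move=> d0; rewrite -[in LHS]iu count_ins ?size_uninsert ?cu.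
  rewrite !e ?(negPf yc) ?addn0; [|lia|lia].
  case: (y.-1 =P c) => [ey|]; last by rewrite addn0.
  have yc1 : y = c.+1 by lia.
  move: cv; rewrite yc1 eqxx (_ : (c.+1 == c) = false) ?e //; last by lia.
  by rewrite eqxx (_ : (c.+1 == c) = false) /=; lia.
rewrite yc in yv *; case: (leqP c 1) => c1.
  have -> : c = 1 by lia.
  rewrite /= uninsert0; exists (size v); rewrite eqxx lv; split=> //=.
    have [iv cc] := ins_out (leqnn (size v)); by rewrite ins_cons iv cc leqnn.
  have [iv cc] := ins_out (leqnn (size v)); by rewrite carry_cons cc leqnn.
move: yv; rewrite leqNgt c1 /= => yv.
have /(IH c.-1 lv) [|x [xv ux lu iu cu]] : count_mem c.-1.+1 v < count_mem c.-1 v.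
- by rewrite prednK.
- lia.
have e d : 0 < d -> count_mem d v = count_mem d (uninsert c.-1 v) + (d == c.-1).
  by move=> d0; rewrite -[in LHS]iu count_ins ?size_uninsert ?cu.
exists x; split; rewrite /= ?size_uninsert ?ins_cons ?carry_cons ?iu ?cu ?eqxx
  ?andbT ?size_uninsert ?(ltnW xv) ?prednK //.
- exact: ltnW.
- by rewrite ltn_eqF.
- rewrite lu andbT; case: (leqP c.-1 1) => //= c2.
  have c3 : 0 < c.-2 by lia.
  have := lattice_count lv c3; have /negPf neq : c.-2 != c.-1 by lia.
  by rewrite prednK ?e ?eqxx ?neq ?addn0 ?addn1 //; lia.
Qed.

(** * The entries bumped out of the first row *)

(** The smallest entry larger than x of row 1, or the length of the word if there
is none: this is what x bumps out of row 1. *)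
Fixpoint next_one (x : nat) (u : seq nat) : nat :=
  if u is y :: v then
    if next_one x v < size v then next_one x v
    else if (x < size v) && (y == 1) then size v else (size v).+1
  else 0.

Lemma next_one_row x u :
  next_one x u < size u -> letter u (next_one x u) = 1 /\ x < next_one x u.
Proof.
elim: u => //= y u IH; case: (ltnP (next_one x u) (size u)) => [zu|_].
  by rewrite ltn_eqF // => _; apply: IH.
by case: ifP => [/andP[xu /eqP->]|]; rewrite ?eqxx ?ltnn.
Qed.

Lemma letter1_lt u r : letter u r = 1 -> r < size u.
Proof. by move=> e; case: ltnP => // /letter_out; rewrite e. Qed.

Lemma next_one_min x u r : letter u r = 1 -> x < r -> next_one x u <= r.
Proof.
elim: u => //= y u IH; case: eqP => [-> -> xu|_ ur xr].
  by case: ltnP => // [/ltnW//|_]; rewrite xu eqxx.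
by rewrite (leq_ltn_trans (IH ur xr) (letter1_lt ur)) IH.
Qed.

Lemma row_ins x u p : x < size u -> letter u x = 0 ->
  (letter (ins x u) p == 1) = (p == x) || ((letter u p == 1) && (p != next_one x u)).
Proof.
suff gen : x < size u -> letter u x = 0 ->
    ((carry x u == 1) = (size u <= next_one x u)) /\
    forall q, (letter (ins x u) q == 1) =
      (q == x) || ((letter u q == 1) && (q != next_one x u)).
  by move=> xu ux; case: (gen xu ux) => _; apply.
elim: u {p} => //= y u IH xu; rewrite ins_cons carry_cons /= size_ins.
case: (eqVneq x (size u)) => [-> y0|nx ux].
  have [iu cu] := ins_out (leqnn (size u)); rewrite iu cu leqnn y0 ltnn /=.
  have -> : (next_one (size u) u < size u) = false.
    by apply/negP => /[dup] /next_one_row [] _; lia.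
  split=> [|q]; first by rewrite leqnn.
  case: (eqVneq q (size u)) => [->|qu] //=.
  case: eqP => //= /letter1_lt; lia.
have xu' : x < size u by lia.
have [cu ru] := IH xu' ux; have c0 := carry_gt0 xu' ux.
rewrite (ltnW xu') xu' /=; split.
  case: (ltnP (next_one x u)) cu => [zu|zu] cu.
    rewrite (leqNgt (size u).+1) ltnS (ltnW zu) /=.
    by case: (y =P carry x u) => // yc; apply/eqP; move/eqP: cu; lia.
  rewrite (eqP cu); case: (y == 1); first by rewrite ltnn.
  by rewrite leqnn.
move=> q; case: (eqVneq q (size u)) => [->|qu]; last first.
  rewrite ru; case: (ltnP (next_one x u)) => // zu.
  case: (eqVneq q x) => //= _; case: eqP => //= /letter1_lt qs.
  by case: ifP => _; lia.
rewrite (_ : (size u == x) = false) /=; last by lia.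
case: (ltnP (next_one x u)) cu => [zu|zu] cu.
  rewrite (gtn_eqF zu) andbT; case: (y =P carry x u) => // yc.
  by rewrite [in RHS]yc cu; apply/eqP; lia.
rewrite (eqP cu); case: (eqVneq y 1) => [_|y1] /=; first by rewrite eqxx.
by rewrite (negPf y1).
Qed.

(** Lowering all letters by one deletes row 1.  On the remaining rows, inserting x
acts as inserting the entry that x bumps out of row 1. *)
Lemma map_pred_ins x u : letter u x = 0 ->
  map predn (ins x u) = ins (next_one x u) (map predn u).
Proof.
suff gen : letter u x = 0 ->
   ((x < size u) -> carry x u = (carry (next_one x u) (map predn u)).+1) /\
   map predn (ins x u) = ins (next_one x u) (map predn u).
  by move=> /gen[].
elim: u => //= y u IH; rewrite !ins_cons !carry_cons /= size_map.
case: (ltngtP x (size u)) => [xu ux|xu ux|-> y0] /=.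
- have [+ iu] := IH ux; move=> /(_ xu) cu.
  have c0 := carry_gt0 xu ux.
  case: (ltnP (next_one x u) (size u)) => zu.
    have c0' : 0 < carry (next_one x u) (map predn u).
      apply: carry_gt0; rewrite ?size_map //.
      have [l1 _] := next_one_row zu; move: l1 zu; move: (next_one x u) => z.
      elim: (u) => //= a v IHv; rewrite size_map.
      case: ifP => [_ -> //|ne l1 zs]; apply: IHv => //; lia.
    rewrite (ltnW zu) cu iu /=.
    have -> : (y == (carry (next_one x u) (map predn u)).+1) =
              (y.-1 == carry (next_one x u) (map predn u)) by lia.
    by case: ifP.
  have [|io co] := @ins_out (next_one x u) (map predn u); first by rewrite size_map.
  rewrite cu co /=; case: (eqVneq y 1) => [->|y1].
    have [|i1 c1] := @ins_out (size u) (map predn u); first by rewrite size_map.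
    by rewrite i1 c1 leqnn iu io.
  have [|i1 c1] := @ins_out (size u).+1 (map predn u); first by rewrite size_map.
  by rewrite i1 c1 ltnn iu io.
- have out z : size u <= z -> size u <= next_one z u.
    by move=> uz; case: leqP => // /[dup] /next_one_row[_]; lia.
  have [io ->] := ins_out (ltnW xu).
  rewrite (ltnNge (next_one x u)) out ?(ltnW xu) //=.
  have [|i1 c1] := @ins_out (size u).+1 (map predn u); first by rewrite size_map.
  by rewrite io i1 c1 ltnn /=; split=> //; rewrite ltnS leqNgt xu.
- have [io ->] := ins_out (leqnn (size u)).
  have -> : (next_one (size u) u < size u) = false.
    by apply/negP => /[dup] /next_one_row [] _; lia.
  have [|i1 c1] := @ins_out (size u).+1 (map predn u); first by rewrite size_map.
  by rewrite leqnn y0 /= !ltnn /= i1 c1 io.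
Qed.

(** The entries bumped out of row 1 when Y is inserted (the word read off
Viennot's shadow lines).  Values beyond the end of the tableau stand for
insertions that bump nothing. *)
Fixpoint bumped (u : seq nat) (Y : seq nat) : seq nat :=
  if Y is x :: Z then next_one x u :: bumped (ins x u) Z else [::].

Fixpoint fresh (u : seq nat) (Y : seq nat) : bool :=
  if Y is x :: Z then (letter u x == 0) && fresh (ins x u) Z else true.

Definition insert_word u Y := foldl (fun u x => ins x u) u Y.

Lemma letter_map_pred u p : letter (map predn u) p = (letter u p).-1.
Proof. by elim: u => //= y u IH; rewrite size_map; case: ifP. Qed.

Lemma letter_next_one x u : letter (map predn u) (next_one x u) = 0.
Proof.
rewrite letter_map_pred; case: (ltnP (next_one x u) (size u)) => [/next_one_row[-> //]|].
by move=> /letter_out ->.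
Qed.

Lemma insert_word_bumped u Y : fresh u Y ->
  map predn (insert_word u Y) = insert_word (map predn u) (bumped u Y) /\
  fresh (map predn u) (bumped u Y).
Proof.
elim: Y u => //= x Y IH u /andP[/eqP ux fY].
by rewrite letter_next_one -map_pred_ins //; apply: IH.
Qed.

(** For each descent from e to d in Y, when d arrives row 1 contains an entry in
(d, e], so that d bumps such an entry, or one was bumped after e arrived; so the
k descents of a decreasing subsequence give a decreasing subsequence of k bumped
entries.  The second statement of the induction describes the situation once e
has arrived. *)
Lemma bumped_chain u Y d s : fresh u Y ->
  path gtn d s -> subseq (d :: s) Y -> d < size u ->
  exists t, [/\ subseq t (bumped u Y), path gtn d.+1 t & size t = size s].
Proof.
suff gen : fresh u Y ->
  (forall d s, path gtn d s -> subseq (d :: s) Y -> d < size u ->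
    exists t, [/\ subseq t (bumped u Y), path gtn d.+1 t & size t = size s]) /\
  (forall e d s r, path gtn d s -> subseq (d :: s) Y -> d < size u ->
    letter u r = 1 -> d < r <= e ->
    exists t, [/\ subseq t (bumped u Y), path gtn e.+1 t & size t = (size s).+1]).
  by move=> f pd sd du; have [g _] := gen f; apply: g.
elim: Y u {d s} => [|x Y IH] u //= /andP[/eqP ux fY].
have [IHB IHA] := IH _ fY; rewrite size_ins in IHA IHB.
(* The part of a chain that follows x, once x has entered row 1. *)
have used s : x < size u -> path gtn x s -> subseq s Y ->
    exists t, [/\ subseq t (bumped (ins x u) Y), path gtn x.+1 t & size t = size s].
  case: s => [|d s] xu /=; first by exists [::]; split=> //; apply: sub0seq.
  move=> /andP[dx pd] sd; apply: (IHA x d s x) => //.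
  - exact: ltn_trans xu.
  - exact: letter_ins_new.
  - by rewrite dx /=.
split=> [d s pd|e d s r pd].
  case: eqP => [dx|_] sd du.
    rewrite dx in pd du *; have [t [st pt <-]] := used s du pd sd.
    by exists t; split=> //; apply: subseq_trans st (subseq_cons _ _).
  have [t [st pt <-]] := IHB d s pd sd du.
  by exists t; split=> //; apply: subseq_trans st (subseq_cons _ _).
case: eqP => [dx|_] sd du ur /andP[dr re].
  rewrite dx in pd du dr *; have [t [st pt <-]] := used s du pd sd.
  have ze : next_one x u <= r := next_one_min ur dr.
  have zu : next_one x u < size u := leq_ltn_trans ze (letter1_lt ur).
  have [_ xz] := next_one_row zu.
  exists (next_one x u :: t); rewrite /= eqxx ltnS (leq_trans ze re) /=; split=> //.
  case: t pt {st} => //= a t /andP[ax ->]; rewrite andbT.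
  by rewrite /= in ax *; lia.
case: (ltnP x (size u)) => xu; last first.
  have [iu _] := ins_out xu; have [//|//|//|||t [st pt <-]] := IHA e d s r.
  - by rewrite iu.
  - by rewrite dr.
  by exists t; split=> //; apply: subseq_trans st (subseq_cons _ _).
have ri := row_ins _ xu ux.
(* If x bumps r, then x replaces r when x > d, and otherwise r is the bumped entry
   for the descent to d. *)
case: (eqVneq r (next_one x u)) => [rz|rz]; last first.
  have [//|//|//|||t [st pt <-]] := IHA e d s r.
  - by apply/eqP; rewrite ri ur rz orbT.
  - by rewrite dr.
  by exists t; split=> //; apply: subseq_trans st (subseq_cons _ _).
have xr : x < r by rewrite rz; apply next_one_row; rewrite -rz (letter1_lt ur).
case: (ltnP d x) => dx.
  have [//|//|//|||t [st pt <-]] := IHA e d s x.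
  - exact: letter_ins_new.
  - by rewrite dx /=; lia.
  by exists t; split=> //; apply: subseq_trans st (subseq_cons _ _).
have [t [st pt <-]] := IHB d s pd sd du.
exists (r :: t); rewrite -rz /= eqxx ltnS re; split=> //=.
by case: t pt {st} => //= a t /andP[ax ->]; rewrite andbT /= in ax *; lia.
Qed.

(** A decreasing sequence y_1 > ... > y_k of bumped entries lifts to one of length
k + 1: before the bump of y_i, take y_i itself if it arrived after the bump of
y_(i-1), and otherwise the letter that bumped y_(i-1), which exceeds y_i
because y_i was in row 1 and was not bumped.  Finish with the letter that
bumped y_k.  The induction distinguishes whether y_1 is in row 1 at the start,
in which case only k letters are found. *)
Lemma chain_of_bumped u Y y t : fresh u Y -> y < size u ->
  path gtn y t -> subseq (y :: t) (bumped u Y) -> letter u y != 1 ->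
  exists s, [/\ subseq s Y, path gtn y.+1 s & size s = (size t).+2].
Proof.
suff gen : fresh u Y -> forall y t, y < size u ->
    path gtn y t -> subseq (y :: t) (bumped u Y) ->
    (letter u y = 1 ->
      exists s, [/\ subseq s Y, path gtn y s & size s = (size t).+1]) /\
  (letter u y != 1 ->
      exists s, [/\ subseq s Y, path gtn y.+1 s & size s = (size t).+2]).
  by move=> f yu p s; have [_] := gen f y t yu p s; apply.
elim: Y u {y t} => [|x Y IH] u //= /andP[/eqP ux fY] y t yu pt.
have {IH} := IH _ fY; rewrite size_ins => IH.
have weak s : subseq s Y -> subseq s (x :: Y).
  by move=> sY; apply: subseq_trans sY (subseq_cons _ _).
case: eqP => [yz st|_ st].
  rewrite yz in yu pt *; have [ly xz] := next_one_row yu; rewrite ly; split=> // _.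
  have xu : x < size u := ltn_trans xz yu.
  case: t pt st => [|y2 t] /=.
    by move=> _ _; exists [:: x]; rewrite /= eqxx sub0seq xz.
  move=> /andP[y2z pt] st; have [] := IH y2 t (ltn_trans y2z yu) pt st.
  case: eqP => [l2 /(_ l2) [s [sY ps <-]] _|l2 _ /(_ isT) [s [sY ps <-]]].
    exists (x :: s); rewrite /= eqxx xz; split=> //=.
    case: s ps {sY} => //= a s /andP[ay ->]; rewrite andbT /= in ay *.
    move/eqP: l2; rewrite row_ins // => /orP[/eqP <- //|/andP[/eqP l2 _]].
    case: (ltnP x y2) => [xy|]; last lia.
    by have := next_one_min l2 xy; lia.
  exists s; split; [exact: weak| |by []].
  by case: s ps {sY} => //= a s /andP[ay ->]; rewrite andbT /= in ay *; lia.
have [IHa IHb] := IH y t yu pt st; split=> ly.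
  case: (eqVneq (letter (ins x u) y) 1) => [/IHa|/IHb] [s [sY ps ss]].
    by exists s; split=> //; apply: weak.
  case: s sY ps ss => //= a s sY /andP[ay ps] [<-]; exists s; split=> //.
    by apply: weak; apply: subseq_trans (subseq_cons _ _) sY.
  by case: s ps {sY} => //= b s /andP[ba ->]; rewrite andbT /= in ay ba *; lia.
case: (eqVneq (letter (ins x u) y) 1) => [/[dup] ly2 /IHa|/IHb] [s [sY ps ss]].
  case: (ltnP x (size u)) => xu; last first.
    by have [iu _] := ins_out xu; rewrite iu in ly2; rewrite ly2 in ly.
  have := row_ins y xu ux; rewrite ly2 eqxx (negPf ly) orbF => /esym/eqP yx.
  exists (x :: s); rewrite /= eqxx -yx; split=> //=; last by rewrite ss.
  by rewrite ltnSn.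
by exists s; split=> //; apply: weak.
Qed.

(** * Schensted's theorem *)

(** The entries smaller than m of the insertion tableau of Y: insertions at m or
beyond leave the word unchanged, so no filtering is needed. *)
Definition tableau m Y := insert_word (nseq m 0) Y.

Lemma letter_nseq0 m p : letter (nseq m 0) p = 0.
Proof. by elim: m => //= m IH; case: ifP. Qed.

Lemma size_insert_word u Y : size (insert_word u Y) = size u.
Proof. by elim: Y u => //= x Y IH u; rewrite IH size_ins. Qed.

Lemma letterP u c : 0 < c -> reflect (exists p, letter u p = c) (c \in u).
Proof.
move=> c0; elim: u => [|y u IH] /=; first by constructor=> -[p] /=; lia.
rewrite inE; apply: (iffP orP) => [[/eqP->|/IH[p up]]|[p]].
- by exists (size u); rewrite eqxx.
- exists p; rewrite ltn_eqF //; case: ltnP => // /letter_out; lia.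
- by case: ifP => [_ ->|_ up]; [left|right; apply/IH; exists p].
Qed.

Lemma path_gtn_le a b t : a <= b -> path gtn a t -> path gtn b t.
Proof. by case: t => //= x t ab /andP[xa ->]; rewrite andbT; apply: leq_trans ab. Qed.

Lemma insert_word1 u Y : fresh u Y ->
  (1 \in insert_word u Y) = (1 \in u) || has (ltn^~ (size u)) Y.
Proof.
elim: Y u => [|x Y IH] u /=; first by rewrite orbF.
move=> /andP[/eqP ux fY]; rewrite IH // size_ins orbA; congr (_ || _).
case: (ltnP x (size u)) => xu; last by have [-> _] := ins_out xu; rewrite orbF.
by rewrite orbT; apply/letterP => //; exists x; rewrite letter_ins_new.
Qed.

(** Each row but the first is a row of the tableau of the bumped entries, and
passing to bumped entries shortens the longest decreasing subsequence by one. *)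
Lemma schensted_rows m Y j : fresh (nseq m 0) Y ->
  reflect (exists s, [/\ subseq s Y, path gtn m s & size s = j.+1])
          (j.+1 \in tableau m Y).
Proof.
have tot p : letter (nseq m 0) p != 1 by rewrite letter_nseq0.
elim: j Y => [|j IH] Y fY.
  rewrite /tableau insert_word1 // mem_nseq andbF size_nseq /=.
  apply: (iffP hasP) => [[x xY xm]|[[|x [|? ?]] [] //= + /andP[xm _] _]].
    by exists [:: x]; rewrite sub1seq /=; split; rewrite ?andbT.
  by rewrite sub1seq => xY; exists x.
have [e f] := insert_word_bumped fY; rewrite map_nseq /= in e f.
have -> : (j.+2 \in tableau m Y) = (j.+1 \in map predn (tableau m Y)).
  apply/idP/mapP => [H|[y yY e1]]; first by exists j.+2.
  by have -> : j.+2 = y by lia.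
rewrite e; apply: (iffP (IH _ f)) => -[[|y s] [] // sY /= /andP[ym ps] [ss]].
  have [||t [tY pt st]] := chain_of_bumped fY _ ps sY; rewrite ?size_nseq //.
  by exists t; split=> //; [apply: path_gtn_le pt|rewrite st ss].
have [|t [tY pt st]] := bumped_chain fY ps sY; rewrite ?size_nseq //.
by exists t; split=> //; [apply: path_gtn_le pt|rewrite st ss].
Qed.

(** The recursion satisfied by the length of a longest increasing subsequence when
x is appended: either it does not use x, or it extends one with letters below
x. *)
Lemma count1_ins x u : x < size u -> letter u x = 0 ->
  count_mem 1 (ins x u) =
  maxn (count_mem 1 u) (count_mem 1 (drop (size u - x) u)).+1.
Proof.
move=> xu ux; rewrite count_ins //; elim: u xu ux => //= y u IH xu.
case: eqP => [xe ->|xe ux].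
  have -> : (size u).+1 - x = 1 by lia.
  rewrite carry_cons xe /= drop0; have [_ ->] := ins_out (leqnn (size u)).
  by rewrite leqnn /=; lia.
have xu' : x < size u by lia.
have := IH xu' ux; have c0 := carry_gt0 xu' ux.
rewrite carry_cons (ltnW xu') subSn 1?ltnW //=.
move: c0; set a := count_mem 1 u; set b := count_mem 1 _; set c := carry x u => c0.
rewrite !(eq_sym 1); case: (eqVneq y c) => [->|yc].
  have -> : (c.+1 == 1) = false by lia.
  by case: (c == 1) => /=; lia.
by case: (eqVneq c 1) yc => [->|_ _]; case: (y == 1) => //=; lia.
Qed.

Lemma drop_ins k x u : drop k (ins x u) = ins x (drop k u).
Proof. by elim: u k => [|y u IH] [|k]; rewrite ?drop0 // ins_cons /= IH. Qed.

Lemma drop_insert_word k u Y : drop k (insert_word u Y) = insert_word (drop k u) Y.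
Proof. by elim: Y u => //= x Y IH u; rewrite IH drop_ins. Qed.

(** Forgetting the largest positions of the tableau of Y leaves the tableau of the
small letters of Y. *)
Lemma drop_tableau k m Y : drop k (tableau m Y) = tableau (m - k) Y.
Proof.
rewrite drop_insert_word; congr insert_word.
by elim: m k => [|m IH] [|k] //=; rewrite IH.
Qed.

Lemma fresh_rcons u Y x :
  fresh u (rcons Y x) = fresh u Y && (letter (insert_word u Y) x == 0).
Proof. by elim: Y u => [|z Y IH] u //=; rewrite ?andbT // IH andbA. Qed.

Lemma insert_word_rcons u Y x :
  insert_word u (rcons Y x) = ins x (insert_word u Y).
Proof. by rewrite /insert_word foldl_rcons. Qed.

Lemma subseq_rconsP (s Y : seq nat) x :
  subseq s (rcons Y x) <->
  subseq s Y \/ exists2 t, s = rcons t x & subseq t Y.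
Proof.
split.
  case/lastP: s => [|s z]; first by left; apply: sub0seq.
  rewrite -subseq_rev !rev_rcons /=; case: eqP => [->|_] H.
    by right; exists s; rewrite // -subseq_rev.
  by left; rewrite -subseq_rev rev_rcons.
case=> [H|[t -> H]]; first by apply: subseq_trans H (subseq_rcons _ _).
by rewrite -!cats1 cat_subseq.
Qed.

Lemma fresh_drop k u Y : fresh u Y -> fresh (drop k u) Y.
Proof.
elim: Y u k => //= z Z IHZ u k /andP[/eqP uz fZ].
rewrite -drop_ins IHZ // andbT; elim: u k uz {IHZ fZ} => [|y u IHu] [|q] //=.
  by move=> ->.
case: eqP => [-> _|_ /IHu//].
by rewrite letter_out // size_drop leq_subr.
Qed.

Lemma fresh_nseq_le m i Y : m <= i -> fresh (nseq i 0) Y -> fresh (nseq m 0) Y.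
Proof. by move=> mi /(fresh_drop (i - m)); rewrite drop_nseq subKn. Qed.

Lemma schensted_columns m Y k : fresh (nseq m 0) Y ->
  k <= count_mem 1 (tableau m Y) <->
  exists s, [/\ subseq s Y, path gtn m (rev s) & size s = k].
Proof.
elim/last_ind: Y m k => [|Y x IH] m k.
  rewrite /tableau /= count_nseq /= mul0n leqn0 => _; split=> [/eqP->|].
    by exists [::].
  by case=> [[|z s] []] // _ _ <-.
rewrite fresh_rcons => /andP[fY /eqP fx].
have -> : k <= count_mem 1 (tableau m (rcons Y x)) <->
  k <= count_mem 1 (tableau m Y) \/
  x < m /\ k.-1 <= count_mem 1 (tableau x Y).
  rewrite /tableau insert_word_rcons.
  have sz : size (insert_word (nseq m 0) Y) = m.
    by rewrite size_insert_word size_nseq.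
  case: (ltnP x m) => xm.
    rewrite count1_ins ?sz // drop_tableau subKn ?(ltnW xm) // leq_max.
    have -> t : (k <= t.+1) = (k.-1 <= t) by lia.
    by split=> [/orP[->|->]|[->|[_ ->]]]; rewrite ?orbT //; [left|right].
  by have [|-> _] := @ins_out x (insert_word (nseq m 0) Y);
     [rewrite sz|split; [left|case=> // -[]]].
have fY' : x < m -> fresh (nseq x 0) Y.
  by move=> /ltnW xm; apply: fresh_nseq_le fY.
split.
  case=> [/(IH _ _ fY) [s [sY ps ss]]|[xm /(IH _ _ (fY' xm)) [s [sY ps ss]]]].
    by exists s; split=> //; apply/subseq_rconsP; left.
  case: k ss => [|k] ss; first by exists [::]; rewrite sub0seq.
  exists (rcons s x); rewrite rev_rcons size_rcons ss; split=> //=.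
    by apply/subseq_rconsP; right; exists s.
  by rewrite xm.
case=> s [/subseq_rconsP [sY|[t -> tY]] ps ss].
  by left; apply/(IH _ _ fY); exists s.
move: ps ss; rewrite rev_rcons size_rcons /= => /andP[xm pt] <-; right; split=> //.
by apply/(IH _ _ (fY' xm)); exists t.
Qed.

Lemma letter_insert_word u Y p : fresh u Y -> p < size u ->
  (letter (insert_word u Y) p == 0) = (letter u p == 0) && (p \notin Y).
Proof.
elim: Y u => [|x Y IH] u /=; first by rewrite andbT.
move=> /andP[/eqP ux fY] pu; rewrite IH ?size_ins // inE negb_or.
case: (eqVneq p x) pu => [->|px] xu /=; last by rewrite letter_ins_eq0.
by rewrite letter_ins_new ?andbF.
Qed.

(** * Lattice words and Young diagrams *)

(** Lattice words of length m, listed explicitly so that sums over them can be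
reindexed along insertion. *)
Fixpoint lattice_words (m : nat) : seq (seq nat) :=
  if m is k.+1 then
    [seq u <- [seq y :: v | v <- lattice_words k, y <- iota 0 k.+2] | lattice u]
  else [:: [::]].

Lemma lattice_letter_le u y : lattice u -> y \in u -> y <= size u.
Proof.
elim: u y => //= z u IH y /andP[zu lu]; rewrite inE => /predU1P[->|/IH]; last first.
  by move=> /(_ lu); lia.
case/orP: zu => [|zu]; first lia.
have /(IH _ lu) : z.-1 \in u by rewrite -has_pred1 has_count (leq_ltn_trans _ zu).
by move=> H; rewrite -ltnS in H *; apply: leq_trans H; case: (z).
Qed.

Lemma mem_lattice_words m u : (u \in lattice_words m) = lattice u && (size u == m).
Proof.
elim: m u => [|m IH] u; first by case: u => //= y u; rewrite andbF.
rewrite mem_filter; case lu: (lattice u) => //; rewrite !andTb.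
apply/allpairsPdep/eqP => [[v [y [vw _ ->]]]|su].
  by move: vw; rewrite IH /= => /andP[_ /eqP->].
case: u lu su => // y v l [sv]; have lv : lattice v by case/andP: l.
exists v, y.
rewrite IH lv sv eqxx mem_iota; split=> //.
by have := lattice_letter_le l (mem_head y v); rewrite /= sv; lia.
Qed.

Lemma lattice_words_uniq m : uniq (lattice_words m).
Proof.
elim: m => // m IH; apply: filter_uniq; apply: allpairs_uniq_dep => //.
  by move=> v _; apply: (iota_uniq 0).
by move=> [v y] [w z] _ _ /= [-> ->].
Qed.

Arguments lattice_words : simpl never.

Section Shapes.
Variable n : nat.
Notation diagram := {set 'I_n * 'I_n}.

(** Rows and columns are numbered from 0, so row i holds the letters i + 1. *)
Definition wshape (u : seq nat) : diagram :=
  [set p : 'I_n * 'I_n | p.2 < count_mem p.1.+1 u].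

Definition young (D : diagram) : bool :=
  [forall p : 'I_n * 'I_n, forall q : 'I_n * 'I_n,
     [&& p \in D, q.1 <= p.1 & q.2 <= p.2] ==> (q \in D)].

Definition covers (D E : diagram) : bool := [exists p in ~: D, E == p |: D].

Lemma youngP (D : diagram) : reflect (forall p q : 'I_n * 'I_n,
    p \in D -> q.1 <= p.1 -> q.2 <= p.2 -> q \in D) (young D).
Proof.
apply: (iffP forallP) => [H p q pD q1 q2|H p].
  by have /forallP/(_ q) := H p; rewrite pD q1 q2.
by apply/forallP => q; apply/implyP => /and3P[pD q1 q2]; apply: H q1 q2.
Qed.

Lemma lattice_count_le u c d : lattice u -> 0 < c -> c <= d ->
  count_mem d u <= count_mem c u.
Proof.
move=> lu c0; elim: d => [|d IH]; first by case: c c0.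
rewrite leq_eqVlt => /predU1P[-> //|cd].
by apply: leq_trans (IH _); [apply: lattice_count => //; lia|lia].
Qed.

Lemma wshape_young u : lattice u -> young (wshape u).
Proof.
move=> lu; apply/youngP => p q; rewrite !inE => pu q1 q2.
by apply: leq_trans (lattice_count_le lu _ _); [apply: leq_ltn_trans pu| |].
Qed.

Lemma wshape_eq_count u v : lattice u -> lattice v -> size u <= n -> size v <= n ->
  wshape u = wshape v -> forall d, 0 < d -> count_mem d u = count_mem d v.
Proof.
suff half a b : lattice a -> size a <= n -> wshape a = wshape b ->
    forall d, 0 < d -> count_mem d a <= count_mem d b.
  move=> lu lv su sv e d d0; apply/eqP.
  by rewrite eqn_leq !half.
move=> la sa e d d0; case: leqP => // lt.
have da : d \in a by rewrite -has_pred1 has_count (leq_ltn_trans _ lt).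
have dn : d.-1 < n by have := lattice_letter_le la da; lia.
have cn : count_mem d b < n.
  by apply: leq_trans lt (leq_trans (count_size _ _) sa).
have : (Ordinal dn, Ordinal cn) \in wshape a by rewrite inE /= prednK.
by rewrite e inE /= prednK // ltnn.
Qed.

Lemma wshape_add u v c (p : 'I_n * 'I_n) :
  (forall d, 0 < d -> count_mem d v = count_mem d u + (d == c)) ->
  (p \in wshape v) =
    (p \in wshape u) || ((p.1.+1 == c) && (p.2 == count_mem c u :> nat)).
Proof.
move=> e; rewrite !inE e //; case: (p.1.+1 =P c) => [->|_] /=.
  by rewrite addn1 ltnS leq_eqVlt orbC.
by rewrite addn0 orbF.
Qed.

Lemma wshape_covers u v c : lattice v -> size v <= n -> 0 < c ->
  (forall d, 0 < d -> count_mem d v = count_mem d u + (d == c)) ->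
  covers (wshape u) (wshape v).
Proof.
move=> lv sv c0 e; have ec := e c c0; rewrite eqxx addn1 in ec.
have cv : c \in v by rewrite -has_pred1 has_count ec.
have cn : c.-1 < n by have := lattice_letter_le lv cv; lia.
have kn : count_mem c u < n by rewrite -ec (leq_trans (count_size _ _)).
apply/existsP; exists (Ordinal cn, Ordinal kn).
rewrite !inE /= prednK // ltnn /=; apply/eqP/setP => -[a b].
rewrite (wshape_add _ e) !inE orbC xpair_eqE -!val_eqE /=; congr (_ && _ || _).
by apply/eqP/eqP; lia.
Qed.

(** If the shape of v exceeds the diagram D by one cell, then this cell is the end
of a row c and a removable corner, and the words v minus one letter c have
shape D. *)
Lemma covers_corner D v : lattice v -> size v <= n -> young D ->
  covers D (wshape v) ->
  exists c, [/\ 0 < c, count_mem c.+1 v < count_mem c v &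
    forall u, lattice u -> size u <= n ->
      (forall d, 0 < d -> count_mem d v = count_mem d u + (d == c)) ->
      wshape u = D].
Proof.
move=> lv sv yD /existsP[p]; rewrite inE => /andP[pD /eqP eE].
have inD (q : 'I_n * 'I_n) : (q \in D) = (q != p) && (q \in wshape v).
  by rewrite eE !inE; case: eqP => [->|]; rewrite ?(negPf pD).
have pv : p.2 < count_mem p.1.+1 v.
  by have := setU11 p D; rewrite -eE inE.
(* D is a Young diagram, so the cell p is at the end of its row and no cell of the
   next row lies in the same column. *)
have right_v : count_mem p.1.+1 v <= p.2.+1.
  rewrite leqNgt; apply/negP => lt.
  have kn : p.2.+1 < n.
    by apply: leq_trans lt (leq_trans (count_size _ _) sv).
  case/negP: pD; apply: (youngP _ yD (p.1, Ordinal kn)) => //=.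
  rewrite inD inE /= lt andbT; apply/eqP => /(congr1 (fun q => val q.2)) /=; lia.
have below_v : count_mem p.1.+2 v <= p.2.
  rewrite leqNgt; apply/negP => lt.
  have rn : p.1.+1 < n.
    have : p.1.+2 \in v by rewrite -has_pred1 has_count (leq_ltn_trans _ lt).
    by move/(lattice_letter_le lv)/leq_trans; apply.
  case/negP: pD; apply: (youngP _ yD (Ordinal rn, p.2)) => //=.
  by rewrite inD inE /= lt andbT; apply/eqP => /(congr1 (fun q => val q.1)) /=; lia.
exists p.1.+1; split=> // [|u lu su e]; first by rewrite (leq_ltn_trans below_v).
apply/setP => q; rewrite inD (wshape_add _ e).
have := e p.1.+1 isT; rewrite eqxx addn1 => ep.
have {}ep : count_mem p.1.+1 u = p.2.
  apply/eqP; rewrite eqn_leq.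
  by move: right_v pv; rewrite ep !ltnS => -> ->.
rewrite ep eqSS; have -> : (q == p) = (q.1 == p.1 :> nat) && (q.2 == p.2 :> nat).
  by case: q p {pD eE inD pv right_v below_v e ep} => a b [c d]; rewrite xpair_eqE.
case: (eqVneq (val q.1) (val p.1)) => [q1|] /=; last by rewrite orbF.
case: (eqVneq (val q.2) (val p.2)) => [q2|] /=; last by rewrite orbF.
by rewrite inE q1 ep q2 ltnn.
Qed.

Definition shape_sum m (F : seq nat -> nat) (D : diagram) : nat :=
  \sum_(u <- lattice_words m | wshape u == D) F u.

Lemma mem_lattice_words_shape m D u :
  (u \in [seq u <- lattice_words m | wshape u == D]) =
  [&& lattice u, size u == m & wshape u == D].
Proof. by rewrite mem_filter mem_lattice_words andbC andbA. Qed.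

(** Insertion is a bijection from pairs (u, x) with u of shape D to words whose
shape covers D: the new box is determined by the two shapes, and reverse
bumping out of its row recovers u and x. *)
Lemma sum_insertions m D F : m <= n -> young D ->
  \sum_(u <- lattice_words m | wshape u == D)
     \sum_(x <- iota 0 m | letter u x == 0) F (ins x u) =
  \sum_(v <- lattice_words m | covers D (wshape v)) F v.
Proof.
move=> mn yD; transitivity (\sum_(v <- [seq ins x u |
    u <- [seq u <- lattice_words m | wshape u == D],
    x <- [seq x <- iota 0 m | letter u x == 0]]) F v).
  rewrite big_allpairs_dep /= big_filter.
  by apply: eq_bigr => u _; rewrite big_filter.
rewrite -[RHS]big_filter.
apply: perm_big; apply: uniq_perm.
- apply: allpairs_uniq_dep => [|u _|]; try by rewrite filter_uniq ?lattice_words_uniq ?iota_uniq.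
  move=> [u x] [v y] /allpairsPdep[u1 [x1 [+ + [e1 e2]]]].
  rewrite -{}e1 -{}e2 {u1 x1} => hu hx.
  move=> /allpairsPdep[u1 [x1 [+ + [e1 e2]]]].
  rewrite -{}e1 -{}e2 {u1 x1} => hv hy /= e.
  move: hu hv hx hy; rewrite !mem_lattice_words_shape !mem_filter !mem_iota !add0n.
  move=> /and3P[lu /eqP su /eqP du] /and3P[lv /eqP sv /eqP dv].
  move=> /andP[/eqP ux xm] /andP[/eqP vy ym].
  have xu : x < size u by rewrite su.
  have yv : y < size v by rewrite sv.
  (* Both carries are the row of the cell by which the common image exceeds D. *)
  have cc : carry x u = carry y v.
    have c0 := carry_gt0 xu ux.
    have := count_ins xu ux c0; rewrite e (count_ins yv vy c0) eqxx.
    rewrite (@wshape_eq_count u v) ?su ?sv ?du // => /addnI.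
    by case: eqP => //.
  have uv : u = v by rewrite -(insK ux) -(insK vy) e cc.
  rewrite -{}uv in e yv vy *; congr (existT _ _ _); apply/eqP.
  case: (eqVneq x y) => // xy.
  have := letter_ins_eq0 vy xy; rewrite -e letter_ins_new // ux //.
- exact/filter_uniq/lattice_words_uniq.
move=> v; apply/allpairsPdep/idP.
  move=> [u [x []]]; rewrite mem_lattice_words_shape mem_filter mem_iota add0n mem_filter.
  move=> /and3P[lu /eqP su /eqP <-] /andP[/eqP ux xm] ->.
  have [li _] := lattice_ins ux lu; rewrite mem_lattice_words li size_ins su eqxx !andbT.
  have xu : x < size u by rewrite su.
  apply: (@wshape_covers _ _ (carry x u)) => //; first by rewrite size_ins su.
  - exact: carry_gt0.
  - by move=> d; apply: count_ins.
rewrite mem_filter mem_lattice_words => /and3P[cv lv /eqP sv].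
have [|c [c0 cc uD]] := covers_corner lv _ yD cv; first by rewrite sv.
have [x [xv ux lu iu cu]] := uninsertP lv c0 cc.
exists (uninsert c v), x; rewrite mem_lattice_words_shape mem_filter mem_iota add0n.
rewrite lu size_uninsert sv eqxx ux -sv xv iu eqxx; split=> //=.
apply/eqP/uD => //; first by rewrite size_uninsert sv.
by move=> d d0; rewrite -{1}iu count_ins ?size_uninsert ?cu.
Qed.

(** Deleting the largest entry: the row of this entry is determined by D and by the
shape that remains, so the word can be recovered. *)
Lemma sum_remove_last m D F : m < n -> young D ->
  \sum_(u <- lattice_words m.+1 | wshape u == D) (head 0 u != 0) * F (behead u) =
  \sum_(v <- lattice_words m | covers (wshape v) D) F v.
Proof.
move=> mn yD.
rewrite (bigID (fun u => head 0 u != 0)) /= [X in _ + X]big1 ?addn0; last first.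
  by move=> u /andP[_ /negPf->].
under eq_bigr => u /andP[_ ->] do rewrite mul1n.
rewrite -big_filter -[LHS](big_map behead predT F) -[RHS]big_filter.
apply: perm_big; apply: uniq_perm.
- rewrite map_inj_in_uniq; first exact/filter_uniq/lattice_words_uniq.
  move=> u v; rewrite !(mem_filter _ _ (lattice_words _)) !mem_lattice_words.
  case: u v => [|c u] [|d v]; rewrite ?andbF ?andFb //=.
  move=> /and3P[/andP[/eqP du c0] /andP[lcu lu] su].
  move=> /and3P[/andP[/eqP dv d0] /andP[lcv lv] sv] e; rewrite {}e in lcu lu su du *.
  congr (_ :: _).
  have su' : size (c :: v) <= n by move: su => /= /eqP ->.
  have sv' : size (d :: v) <= n by move: sv => /= /eqP ->.
  have l1 : lattice (c :: v) by rewrite /= lcu.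
  have l2 : lattice (d :: v) by rewrite /= lcv.
  have c1 : 0 < c by lia.
  have := wshape_eq_count l1 l2 su' sv' (etrans du (esym dv)) c1.
  by move=> /= /addIn; rewrite eqxx; case: eqP => //.
- exact/filter_uniq/lattice_words_uniq.
move=> v; rewrite mem_filter; apply/mapP/idP.
  move=> [[|c u]]; rewrite mem_filter mem_lattice_words ?andbF // => /and3P[].
  move=> /andP[/eqP <- /= c0] lu su ->; have /andP[_ lv] := lu.
  rewrite mem_lattice_words lv -eqSS su !andbT.
  apply: (@wshape_covers _ _ c) => //; [by move/eqP: su => /= ->|by lia|].
  by move=> d d0 /=; rewrite addnC eq_sym.
rewrite mem_lattice_words => /and3P[/existsP[p]]; rewrite inE => /andP[pv /eqP eD] lv /eqP sv.
have inD (q : 'I_n * 'I_n) : (q \in D) -> q != p -> q \in wshape v.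
  by rewrite eD !inE => /orP[->|].
have pD : p \in D by rewrite eD setU11.
have right_v : count_mem p.1.+1 v = p.2.
  apply/eqP; rewrite eqn_leq; apply/andP.
  split; first by move: pv; rewrite ?inE -leqNgt.
  rewrite leqNgt; apply/negP => lt.
  have kn : count_mem p.1.+1 v < n.
    by apply: leq_trans lt _; apply: ltnW.
  have : (p.1, Ordinal kn) \in wshape v.
    apply: inD; first by apply: (youngP _ yD p) => //=; apply: ltnW.
    by apply/eqP => /(congr1 (fun q => val q.2)) /= e; rewrite e ltnn in lt.
  by rewrite inE /= ltnn.
(* The cell above p belongs to D, hence to the shape of v. *)
have lpv : lattice (p.1.+1 :: v).
  rewrite /= lv andbT right_v; case: (posnP p.1) => [-> //|p0].
  apply/orP; right; have rn : p.1.-1 < n by have := ltn_ord p.1; lia.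
  have : (Ordinal rn, p.2) \in wshape v.
    apply: inD; first by apply: (youngP _ yD p) => //=; apply: leq_pred.
    apply/eqP => /(congr1 (fun q => val q.1)) /= e.
    by move: p0; rewrite -(ltn_predL p.1) e ltnn.
  by rewrite inE /= prednK.
exists (p.1.+1 :: v) => //; rewrite (mem_filter _ _ (lattice_words _)) mem_lattice_words lpv /= sv.
rewrite eqxx !andbT; apply/eqP/setP => q.
rewrite (@wshape_add v _ p.1.+1) => [|d _]; last by rewrite /= addnC eq_sym.
rewrite eD !inE right_v eqSS orbC; congr (_ || _).
Qed.

Lemma sum_remove_last0 m D F :
  \sum_(u <- lattice_words m.+1 | wshape u == D) (head 0 u == 0) * F (behead u) =
  \sum_(v <- lattice_words m | wshape v == D) F v.
Proof.
rewrite (bigID (fun u => head 0 u == 0)) /= [X in _ + X]big1 ?addn0; last first.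
  by move=> u /andP[_ /negPf->].
under eq_bigr => u /andP[_ ->] do rewrite mul1n.
rewrite -big_filter -[LHS](big_map behead predT F) -[RHS]big_filter.
have sh0 v : wshape (0 :: v) = wshape v by apply/setP => q; rewrite !inE.
apply: perm_big; apply: uniq_perm.
- rewrite map_inj_in_uniq; first exact/filter_uniq/lattice_words_uniq.
  move=> u v; rewrite !(mem_filter _ _ (lattice_words _)) !mem_lattice_words.
  case: u v => [|c u] [|d v]; rewrite ?andbF ?andFb //=.
  by move=> /andP[/andP[_ /eqP->] _] /andP[/andP[_ /eqP->] _] ->.
- exact/filter_uniq/lattice_words_uniq.
move=> v; rewrite mem_lattice_words_shape; apply/mapP/and3P.
  move=> [[|c u]]; rewrite (mem_filter _ _ (lattice_words _)) mem_lattice_words ?andbF //=.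
  move=> /and3P[/andP[+ /eqP c0] lu su] ->; rewrite c0 sh0 => du.
  by rewrite -eqSS; split=> //; case/andP: lu.
move=> [lv sv dv]; exists (0 :: v) => //.
by rewrite (mem_filter _ _ (lattice_words _)) mem_lattice_words /= sh0 dv lv eqSS.
Qed.

End Shapes.

(** * Counting by walks in Young's lattice *)

Section Walks.
Variable n : nat.
Notation diagram := {set 'I_n * 'I_n}.
Implicit Types (D E : diagram) (F : seq nat -> nat) (G : diagram -> nat).

Definition fits j k D :=
  [forall p : 'I_n * 'I_n, (p \in D) ==> (p.1.+1 < j) && (p.2.+1 < k)].

(** Less than j rows and less than k columns.  For a lattice word the first row is
the longest. *)
Definition bounded j k (u : seq nat) :=
  all (ltn^~ j) u && (count_mem 1 u < k).

Lemma bounded_fits j k u : 0 < j -> 0 < k -> lattice u -> size u <= n ->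
  bounded j k u = fits j k (wshape n u).
Proof.
move=> j0 k0 lu su; apply/andP/forallP => [[/allP uj uk] p|H].
  apply/implyP; rewrite inE => lt; apply/andP; split.
    by apply: uj; rewrite -has_pred1 has_count (leq_ltn_trans _ lt).
  by apply: leq_ltn_trans uk; apply: leq_trans lt (lattice_count_le _ _ _).
have cell c : 0 < c -> 0 < count_mem c u -> (c < j) && (count_mem c u < k).
  move=> c0 cu; have cin : c \in u by rewrite -has_pred1 has_count.
  have cn : c.-1 < n by have := lattice_letter_le lu cin; lia.
  have kn : (count_mem c u).-1 < n.
    by rewrite prednK // (leq_trans (count_size _ _)).
  by have /implyP := H (Ordinal cn, Ordinal kn); rewrite inE /= !prednK //; apply.
split; last by case: (posnP (count_mem 1 u)) => [-> //|/(cell 1 isT)/andP[]].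
apply/allP => -[//|c]; rewrite -has_pred1 has_count.
by move=> /(cell c.+1 isT)/andP[].
Qed.

(** Reading an opener from right to left: the last position must be an entry if
and only if l holds, and it is removed. *)
Definition open_step l F u := ((head 0 u != 0) == l) * F (behead u).

Definition close_step j k m (c : bool) F u :=
  if c then \sum_(x <- iota 0 m | letter u x == 0)
    bounded j k (ins x u) * F (ins x u) else F u.

(** The effect of [open_step] on sums over all words of a given shape. *)
Definition diag_open (l : bool) G D :=
  if l then \sum_(E | young E && covers E D) G E else G D.

Definition diag_close j k (c : bool) G D :=
  if c then \sum_(E | young E && covers D E) fits j k E * G E else G D.

(** Lattice words have Young diagrams as shapes, so restricting the sum to these
loses nothing. *)
Lemma shape_sum_group m (P : pred diagram) F :
  \sum_(v <- lattice_words m | P (wshape n v)) F v =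
  \sum_(E : diagram | young E && P E) shape_sum m F E.
Proof.
rewrite big_seq_cond (partition_big (@wshape n) (fun E => young E && P E)) /=.
  apply: eq_bigr => E /andP[yE PE]; rewrite /shape_sum [RHS]big_seq_cond.
  apply: eq_bigl => v; case: eqP => [->|]; last by rewrite !andbF.
  by rewrite PE !andbT.
by move=> v /andP[]; rewrite mem_lattice_words => /andP[/wshape_young-> _] ->.
Qed.

Lemma shape_sum_open m l F D : m < n -> young D ->
  shape_sum m.+1 (open_step l F) D = diag_open l (shape_sum m F) D.
Proof.
move=> mn yD; case: l; rewrite /diag_open /shape_sum.
  rewrite -(shape_sum_group m (fun E => covers E D)) -sum_remove_last //.
  by apply: eq_bigr => u _; rewrite /open_step eqb_id.
rewrite -[RHS]sum_remove_last0; apply: eq_bigr => u _.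
by rewrite /open_step eqbF_neg negbK.
Qed.

Lemma shape_sum_close j k m c F D : 0 < j -> 0 < k -> m <= n -> young D ->
  shape_sum m (close_step j k m c F) D = diag_close j k c (shape_sum m F) D.
Proof.
move=> j0 k0 mn yD; case: c; rewrite // /diag_close /shape_sum /close_step.
rewrite (sum_insertions (fun v => bounded j k v * F v)) //.
rewrite (shape_sum_group m (fun E => covers D E)); apply: eq_bigr => E _.
rewrite big_distrr /= /shape_sum big_seq_cond [RHS]big_seq_cond.
apply: eq_bigr => v /andP[]; rewrite mem_lattice_words => /andP[lv /eqP sv] /eqP <-.
by rewrite (@bounded_fits j k) // sv.
Qed.

Definition transpose D : diagram := [set p | (p.2, p.1) \in D].

Lemma transposeK : involutive transpose.
Proof. by move=> D; apply/setP => -[a c]; rewrite !inE. Qed.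

Lemma young_transpose D : young (transpose D) = young D.
Proof.
suff half E : young E -> young (transpose E).
  by apply/idP/idP => /half //; rewrite transposeK.
move=> /youngP yE; apply/youngP => p q; rewrite !inE => pE q1 q2.
exact: yE pE _ _.
Qed.

Lemma covers_transpose D E : covers (transpose D) (transpose E) = covers D E.
Proof.
suff half A B : covers A B -> covers (transpose A) (transpose B).
  by apply/idP/idP => /half //; rewrite !transposeK.
move=> /existsP[p]; rewrite inE => /andP[pA /eqP->].
apply/existsP; exists (p.2, p.1); rewrite !inE -surjective_pairing pA /=.
apply/eqP/setP => -[a c]; rewrite !inE; congr (_ || _).
by case: p {pA} => a' c'; rewrite !xpair_eqE andbC.
Qed.

Lemma fits_transpose j k D : fits k j (transpose D) = fits j k D.
Proof.
suff half a c A : fits a c A -> fits c a (transpose A).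
  by apply/idP/idP => /half //; rewrite transposeK.
move=> /forallP H; apply/forallP => p; apply/implyP; rewrite inE.
by move/(implyP (H (p.2, p.1))); rewrite andbC.
Qed.

Variables (b : bool) (L R : pred nat).

(** The number of ways to read the vertices i - 1, ..., 0, starting from a given
tableau, such that each tableau obtained by an insertion is bounded.  At vertex
m, L m tells whether m is an opener and R m whether it is a closer; b selects
which of these two events comes first. *)
Fixpoint tab_count j k i : seq nat -> nat :=
  if i is m.+1 then
    if b then close_step j k m.+1 (R m) (open_step (L m) (tab_count j k m))
    else open_step (L m) (close_step j k m (R m) (tab_count j k m))
  else fun=> 1.

(** The same count for walks in Young's lattice that end at the empty diagram. *)
Fixpoint walk_count j k i : diagram -> nat :=
  if i is m.+1 then
    if b then diag_close j k (R m) (diag_open (L m) (walk_count j k m))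
    else diag_open (L m) (diag_close j k (R m) (walk_count j k m))
  else fun D => (D == set0).

Lemma eq_diag_open l G1 G2 D : (forall E, young E -> G1 E = G2 E) -> young D ->
  diag_open l G1 D = diag_open l G2 D.
Proof.
rewrite /diag_open => e yD; case: l; last exact: e.
by apply: eq_bigr => E /andP[/e].
Qed.

Lemma eq_diag_close j k c G1 G2 D :
  (forall E, young E -> G1 E = G2 E) -> young D ->
  diag_close j k c G1 D = diag_close j k c G2 D.
Proof.
rewrite /diag_close => e yD; case: c; last exact: e.
by apply: eq_bigr => E /andP[/e->].
Qed.

(** Single tableaux of the same shape may have different counts; only the sum over
all tableaux of a shape is a number of walks. *)
Lemma shape_sum_tab_count j k i D : 0 < j -> 0 < k -> i <= n -> young D ->
  shape_sum i (tab_count j k i) D = walk_count j k i D.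
Proof.
move=> j0 k0; elim: i D => [|i IH] D i_n yD.
  rewrite /shape_sum /lattice_words big_cons big_nil eq_sym /=.
  by have -> : wshape n [::] = set0; [apply/setP => q; rewrite !inE|case: eqP].
have IH' E : young E -> shape_sum i (tab_count j k i) E = walk_count j k i E.
  by apply: IH; apply: ltnW.
rewrite /=; case: b.
  rewrite shape_sum_close //; apply: eq_diag_close => // E yE.
  by rewrite shape_sum_open //; apply: eq_diag_open.
rewrite shape_sum_open //; apply: eq_diag_open => // E yE.
by rewrite shape_sum_close // 1?ltnW //; apply: eq_diag_close.
Qed.

Lemma diag_open_transpose l G1 G2 D :
  (forall E, G1 E = G2 (transpose E)) ->
  diag_open l G1 D = diag_open l G2 (transpose D).
Proof.
rewrite /diag_open => e; case: l; last exact: e.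
rewrite [RHS](reindex_inj (can_inj transposeK)) /=; apply: eq_big => E.
  by rewrite young_transpose covers_transpose.
by rewrite e.
Qed.

Lemma diag_close_transpose j k c G1 G2 D :
  (forall E, G1 E = G2 (transpose E)) ->
  diag_close j k c G1 D = diag_close k j c G2 (transpose D).
Proof.
rewrite /diag_close => e; case: c; last exact: e.
rewrite [RHS](reindex_inj (can_inj transposeK)) /=; apply: eq_big => E.
  by rewrite young_transpose covers_transpose.
by rewrite e fits_transpose.
Qed.

Lemma walk_count_transpose j k i D :
  walk_count j k i D = walk_count k j i (transpose D).
Proof.
elim: i D => [|i IH] D /=.
  congr (nat_of_bool _); apply/eqP/eqP => [->|].
    by apply/setP => q; rewrite !inE.
  by move=> e; rewrite -[D]transposeK e; apply/setP => q; rewrite !inE.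
case: b.
  by apply: diag_close_transpose => E; apply: diag_open_transpose.
by apply: diag_open_transpose => E; apply: diag_close_transpose.
Qed.

Lemma shape_sum0 F : shape_sum n F (set0 : diagram) = F (nseq n 0).
Proof.
rewrite /shape_sum -big_filter.
rewrite (perm_big [:: nseq n 0]) ?big_seq1 //.
have l0 m : lattice (nseq m 0) by elim: m.
have s0 : wshape n (nseq n 0) = set0.
  by apply/setP => q; rewrite !inE count_nseq.
apply: uniq_perm => //; first exact/filter_uniq/lattice_words_uniq.
move=> u; rewrite mem_lattice_words_shape inE; apply/and3P/eqP => [[lu su du]|->].
  rewrite -(eqP su); apply/all_pred1P/allP => y yu.
  case: (posnP y) => [-> //|y0].
  have : 0 < count_mem y u by rewrite -has_count has_pred1.
  rewrite (@wshape_eq_count n u (nseq n 0)) ?size_nseq ?(eqP su) ?s0 ?(eqP du) //.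
  by rewrite count_nseq /= ltn_eqF.
by rewrite l0 size_nseq s0.
Qed.

(** The empty diagram is the shape of a single tableau, so for it the sum over
shapes is [tab_count] itself. *)
Theorem tab_count_sym j k : 0 < j -> 0 < k ->
  tab_count j k n (nseq n 0) = tab_count k j n (nseq n 0).
Proof.
move=> j0 k0; have y0 : young (set0 : diagram).
  by apply/youngP => p q; rewrite inE.
rewrite -!shape_sum0 !shape_sum_tab_count // walk_count_transpose.
by congr walk_count; apply/setP => q; rewrite !inE.
Qed.

End Walks.

(** * Partner sequences *)

Lemma size_tableau m Y : size (tableau m Y) = m.
Proof. by rewrite size_insert_word size_nseq. Qed.

Lemma letter_tableau m Y p : fresh (nseq m 0) Y -> p < m ->
  (letter (tableau m Y) p == 0) = (p \notin Y).
Proof.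
by move=> fY pm; rewrite letter_insert_word ?size_nseq // letter_nseq0.
Qed.

Lemma fresh_uniq m Y : uniq Y -> fresh (nseq m 0) Y.
Proof.
elim/last_ind: Y => // Y x IH; rewrite rcons_uniq fresh_rcons => /andP[xY uY].
rewrite IH //=; case: (ltnP x m) => xm; last by rewrite letter_out ?size_tableau.
by rewrite letter_tableau // IH.
Qed.

Lemma head_tableau m Y : uniq Y -> (head 0 (tableau m.+1 Y) != 0) = (m \in Y).
Proof.
move=> uY; have := letter_tableau (fresh_uniq m.+1 uY) (ltnSn m).
case: (tableau m.+1 Y) (size_tableau m.+1 Y) => //= y u [->].
by rewrite eqxx => ->; rewrite negbK.
Qed.

Lemma behead_tableau m Y : behead (tableau m.+1 Y) = tableau m Y.
Proof. by rewrite -drop1 drop_tableau subn1. Qed.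

Lemma sum_tuple_cons (T : finType) m (F : seq T -> nat) :
  \sum_(t : m.+1.-tuple T) F t = \sum_x \sum_(t : m.-tuple T) F (x :: t).
Proof.
rewrite pair_big /= (reindex (fun p : T * m.-tuple T => [tuple of p.1 :: p.2])) //=.
exists (fun t : m.+1.-tuple T => (thead t, [tuple of behead t])) => [[x t] _|t _].
  by rewrite /= theadE; congr (_, _); apply: val_inj.
by rewrite /= -tuple_eta.
Qed.

Lemma sum_option (T : finType) (F : option T -> nat) :
  \sum_x F x = F None + \sum_x F (Some x).
Proof.
rewrite (bigD1 None) //=; congr (_ + _).
rewrite (reindex_omap Some id) /=; last by case.
by apply: eq_bigl => x; rewrite eqxx.
Qed.

Section Choices.
Variables (n : nat) (b : bool) (L R : pred nat) (j k : nat).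

Definition extend (Y : seq nat) (x : option nat) :=
  if x is Some a then rcons Y a else Y.

(** The list xs holds the partners of the vertices i - 1, ..., 0, with None for a
vertex that is not a closer, and Y the partners of the vertices already read,
in the order of reading.  Openers are not deleted from Y; looking at the
tableau of Y below m + b has the same effect. *)
Fixpoint valid i (xs : seq (option nat)) (Y : seq nat) : bool :=
  if i is m.+1 then
    if xs is x :: xs' then
      [&& isSome x == R m,
          if x is Some a then
            [&& a < m + b, a \notin Y & bounded j k (tableau (m + b) (rcons Y a))]
          else true,
          (m \in extend Y x) == L m & valid m xs' (extend Y x)]
    else false
  else nilp xs.

Lemma tab_count_step m Y : uniq Y ->
  tab_count b L R j k m.+1 (tableau m.+1 Y) =
  if R m then \sum_(a <- iota 0 (m + b) | a \notin Y)
     bounded j k (tableau (m + b) (rcons Y a)) *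
     (((m \in rcons Y a) == L m) * tab_count b L R j k m (tableau m (rcons Y a)))
  else ((m \in Y) == L m) * tab_count b L R j k m (tableau m Y).
Proof.
move=> uY; rewrite [tab_count b L R j k m.+1 _]/= /close_step /open_step.
have ext i a : ins a (tableau i Y) = tableau i (rcons Y a).
  by rewrite /tableau insert_word_rcons.
have fY i := fresh_uniq i uY.
case: b; rewrite ?addn1 ?addn0 ?[if _ then _ else (fun=> _)]/=.
  case: (R m); last by rewrite head_tableau // behead_tableau.
  rewrite [LHS]big_seq_cond [RHS]big_seq_cond; apply: eq_big => [a|a].
    rewrite mem_iota /=; case: ltnP => // am; by rewrite letter_tableau.
  rewrite mem_iota /= => /andP[am]; rewrite letter_tableau // => aY.
  by rewrite ext head_tableau ?behead_tableau // rcons_uniq aY.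
rewrite head_tableau // behead_tableau; case: (R m) => //.
rewrite big_distrr /= [LHS]big_seq_cond [RHS]big_seq_cond; apply: eq_big => [a|a].
  by rewrite mem_iota /=; case: ltnP => // am; rewrite letter_tableau.
rewrite mem_iota /= => /andP[am]; rewrite letter_tableau // => aY.
by rewrite ext mem_rcons inE gtn_eqF //= mulnCA.
Qed.

Lemma tab_count_valid i Y : i <= n -> uniq Y ->
  tab_count b L R j k i (tableau i Y) =
  \sum_(xs : i.-tuple (option 'I_n)) valid i (map (omap val) xs) Y.
Proof.
elim: i Y => [|m IH] Y mn uY.
  rewrite (big_pred1 [tuple]) // => t; apply/esym/eqP; exact: tuple0.
rewrite tab_count_step // (sum_tuple_cons _ (fun xs : seq (option 'I_n) =>
  nat_of_bool (valid m.+1 (map (omap val) xs) Y))).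
rewrite sum_option /=; case: (R m) => /=; last first.
  rewrite [X in _ + X]big1 ?addn0 => [|a _]; last by rewrite big1.
  by rewrite IH ?(ltnW mn) // big_distrr; apply: eq_bigr => t _; rewrite /= mulnb.
rewrite [X in _ = X + _]big1 // add0n.
have mbn : m + b <= n by case: b => /=; lia.
transitivity (\sum_(a < m + b | (a : nat) \notin Y) \sum_(t : m.-tuple (option 'I_n))
  [&& [&& a < m + b, (a : nat) \notin Y & bounded j k (tableau (m + b) (rcons Y a))],
   (m \in rcons Y a) == L m & valid m [seq omap val i | i <- t] (rcons Y a)]).
  rewrite -{1}(subn0 (m + b)) -/(index_iota 0 (m + b)) big_mkord.
  apply: eq_bigr => a aY; rewrite IH ?(ltnW mn) ?rcons_uniq ?aY //.
  rewrite !big_distrr; apply: eq_bigr => t _; rewrite /= ltn_ord /=.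
  by rewrite !mulnb.
rewrite (big_ord_widen_cond n (fun a => a \notin Y) (fun a => \sum_(t : m.-tuple (option 'I_n))
  [&& [&& a < m + b, a \notin Y & bounded j k (tableau (m + b) (rcons Y a))],
   (m \in rcons Y a) == L m & valid m [seq omap val i | i <- t] (rcons Y a)])) //.
rewrite big_mkcond; apply: eq_bigr => a _; case: ifP => // /negbT.
rewrite negb_and negbK => h; rewrite big1 // => t _.
by case/orP: h => [->|/negPf->]; rewrite ?andbF.
Qed.

End Choices.

(** * One layer of arcs *)

Section Layer.
Variable n : nat.
Notation layer := {ffun 'I_n -> option 'I_n}.
Implicit Types g : layer.

(** Vertices are read from right to left, so lists of vertices are decreasing. *)
Definition vgt (x y : 'I_n) := y < x.

Lemma vgt_trans : transitive vgt.
Proof. by move=> y x z yx zy; apply: ltn_trans zy yx. Qed.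

Lemma vgt_irr : irreflexive vgt.
Proof. by move=> x; apply: ltnn. Qed.

Definition downs : seq 'I_n := rev (enum 'I_n).

Lemma mem_downs v : v \in downs.
Proof. by rewrite mem_rev mem_enum. Qed.

Lemma downs_sorted : sorted vgt downs.
Proof.
by rewrite rev_sorted; have := iota_ltn_sorted 0 n; rewrite -val_enum_ord sorted_map.
Qed.

Lemma downsE : downs = [seq rev_ord i | i <- enum 'I_n].
Proof.
apply: (irr_sorted_eq vgt_trans vgt_irr downs_sorted).
  have := iota_ltn_sorted 0 n; rewrite -val_enum_ord !sorted_map.
  apply: sub_sorted => i j /=; rewrite /vgt /= => ij.
  by have := ltn_ord j; lia.
move=> w; rewrite mem_downs; apply/esym/mapP.
by exists (rev_ord w); rewrite ?mem_enum ?rev_ordK.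
Qed.

Lemma vgt_subseq s l : sorted vgt s -> sorted vgt l -> {subset s <= l} ->
  subseq s l.
Proof.
move=> ss sl sub; rewrite (_ : s = [seq w <- l | w \in s]) ?filter_subseq //.
apply: (irr_sorted_eq vgt_trans vgt_irr) => //.
  exact/sorted_filter/sl/vgt_trans.
by move=> w; rewrite mem_filter; case ws: (w \in s) => //=; rewrite sub.
Qed.

Definition below m := [seq w : 'I_n <- downs | w < m].
Definition above m := [seq w : 'I_n <- downs | m <= w].

Lemma below_sorted m : sorted vgt (below m).
Proof. exact/sorted_filter/downs_sorted/vgt_trans. Qed.

Lemma above_sorted m : sorted vgt (above m).
Proof. exact/sorted_filter/downs_sorted/vgt_trans. Qed.

Lemma below_cons (v : 'I_n) : below v.+1 = v :: below v.
Proof.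
apply: (irr_sorted_eq vgt_trans vgt_irr); first exact: below_sorted.
  rewrite /= path_sortedE; last exact: vgt_trans.
  by rewrite below_sorted andbT; apply/allP => w; rewrite mem_filter => /andP[].
by move=> w; rewrite inE !mem_filter !mem_downs !andbT ltnS leq_eqVlt -val_eqE.
Qed.

Lemma above_rcons (v : 'I_n) : above v = rcons (above v.+1) v.
Proof.
apply: (irr_sorted_eq vgt_trans vgt_irr); first exact: above_sorted.
  rewrite -rev_sorted rev_rcons /= path_sortedE; last first.
    by move=> y x z; rewrite /vgt => xy yz; apply: ltn_trans yz.
  rewrite rev_sorted above_sorted andbT; apply/allP => w.
  by rewrite mem_rev mem_filter => /andP[].
move=> w; rewrite mem_rcons inE !mem_filter !mem_downs !andbT.
by rewrite leq_eqVlt -val_eqE eq_sym.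
Qed.

Definition partners g m : seq nat := map val (pmap g (above m)).

Lemma partners_step g (v : 'I_n) :
  partners g v = extend (partners g v.+1) (omap val (g v)).
Proof.
rewrite /partners above_rcons -cats1 pmap_cat map_cat /=.
by case: (g v) => [x|] /=; rewrite ?cats0 ?cats1.
Qed.

Lemma mem_partners g m (x : 'I_n) :
  reflect (exists2 w : 'I_n, m <= w & g w = Some x) (val x \in partners g m).
Proof.
rewrite (mem_map val_inj) mem_pmap.
apply: (iffP mapP) => [[w]|[w mw gw]].
  by rewrite mem_filter mem_downs andbT => mw e; exists w.
by exists w; rewrite ?mem_filter ?mem_downs ?andbT.
Qed.

Definition layer_closers g : {set 'I_n} := [set v | isSome (g v)].
Definition layer_openers g : {set 'I_n} :=
  [set x | [exists v, g v == Some x]].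

(** Loops are allowed exactly if b holds.  That a vertex is the right endpoint of
at most one arc is built into the type of g. *)
Definition matching (b : bool) g : bool :=
  [forall v, forall x, (g v == Some x) ==>
    (x < v + b) && [forall w, (g w == Some x) ==> (w == v)]].

Definition tab_bounded b j k g : bool :=
  [forall v : 'I_n, isSome (g v) ==>
     bounded j k (tableau (v + b) (partners g v))].

Lemma matchingP (b : bool) g : reflect
  ((forall v x : 'I_n, g v = Some x -> x < v + b) /\
   (forall v w x, g v = Some x -> g w = Some x -> v = w))
  (matching b g).
Proof.
apply: (iffP forallP) => [H|[H1 H2] v].
  have H' v x : g v = Some x ->
      x < v + b /\ forall w, g w = Some x -> w = v.
    move=> /eqP gv; have /forallP/(_ x)/implyP/(_ gv)/andP[-> /forallP Hw] := H v.
    by split=> // w /eqP gw; apply/eqP; have /implyP := Hw w; apply.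
  split=> [v x /H'[]//|v w x gv gw].
  by have [_ h] := H' _ _ gw; apply: h.
apply/forallP => x; apply/implyP => /eqP gv; rewrite (H1 _ _ gv) /=.
by apply/forallP => w; apply/implyP => /eqP gw; rewrite (H2 _ _ _ gv gw).
Qed.

Lemma partners_uniq (b : bool) g m : matching b g -> uniq (partners g m).
Proof.
case/matchingP => _ inj; rewrite (map_inj_uniq val_inj).
have : uniq (above m) by apply: filter_uniq; rewrite rev_uniq enum_uniq.
elim: (above m) => //= v s IH /andP[vs us]; rewrite /oapp.
case gv: (g v) => [x|] /=; last exact: IH.
rewrite IH // andbT mem_pmap; apply/mapP => -[w ws /esym gw].
by rewrite (inj _ _ _ gv gw) ws in vs.
Qed.

(** A set of vertices as a predicate on numbers, as [tab_count] expects. *)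
Definition mem_nat (A : {set 'I_n}) (i : nat) : bool := [exists v in A, val v == i].

Lemma mem_natE A (v : 'I_n) : mem_nat A v = (v \in A).
Proof.
apply/existsP/idP => [[w /andP[wA /eqP/val_inj <-]] //|vA].
by exists v; rewrite vA eqxx.
Qed.

Section Valid.
Variables (b : bool) (L R : {set 'I_n}) (j k : nat).

Definition local_valid g (v : 'I_n) : bool :=
  [&& isSome (g v) == (v \in R),
      if g v is Some x then
        [&& x < v + b, val x \notin partners g v.+1 &
            bounded j k (tableau (v + b) (partners g v))]
      else true &
      (val v \in partners g v) == (v \in L)].

(** The word of partners read before vertex m is [partners g m], so the recursion
of [valid] amounts to one local condition for each vertex. *)
Lemma validE g m : m <= n ->
  valid b (mem_nat L) (mem_nat R) j k m [seq omap val (g w) | w <- below m]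
    (partners g m) = all (local_valid g) (below m).
Proof.
elim: m => [_|m IH mn] /=; first by rewrite /below; elim: downs.
pose v := Ordinal mn; rewrite -[m]/(nat_of_ord v) below_cons /=.
have /= e := partners_step g v; rewrite -/(nat_of_ord v) -e.
rewrite {}IH ?(ltnW mn) // -[m]/(nat_of_ord v) !mem_natE /local_valid.
by case: (g v) e => [x|] /= e; rewrite -?e -!andbA.
Qed.

Lemma valid_layer g :
  valid b (mem_nat L) (mem_nat R) j k n [seq omap val (g w) | w <- downs] [::] =
  [&& layer_openers g == L, layer_closers g == R, matching b g &
      tab_bounded b j k g].
Proof.
have downsE : downs = below n.
  by apply/esym/all_filterP/allP => w _; apply: ltn_ord.
have p0 : partners g n = [::].
  rewrite /partners /above (_ : [seq _ <- _ | _] = [::]) //.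
  by apply/eqP; rewrite -[_ == _]negbK -has_filter; apply/hasPn => w _; rewrite -ltnNge.
rewrite downsE -p0 validE // -downsE.
apply/allP/and4P => [H|[/eqP eL /eqP eR mg /forallP tb] v _]; last first.
  have [dir inj] := matchingP _ _ mg; rewrite /local_valid -eL -eR !inE eqxx /=.
  case gv: (g v) => [x|] /=.
    rewrite (dir _ _ gv); have := tb v; rewrite gv /= => ->; rewrite andbT.
    apply/andP; split.
      apply/mem_partners => -[w vw gw].
      by rewrite (inj _ _ _ gv gw) ltnn in vw.
    apply/eqP; apply/mem_partners/existsP => [[w _ gw]|[w /eqP gw]]; exists w => //.
      exact/eqP.
    by have := dir _ _ gw; case: (b); lia.
  apply/eqP; apply/mem_partners/existsP => [[w _ gw]|[w /eqP gw]]; exists w => //.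
    exact/eqP.
  by have := dir _ _ gw; case: (b); lia.
have {}H v := H v (mem_downs v).
have dir (v x : 'I_n) : g v = Some x -> x < v + b.
  by move=> gv; have := H v; rewrite /local_valid gv => /and3P[_ /and3P[]].
split.
- apply/eqP/setP => v; have /and3P[_ _ /eqP <-] := H v; rewrite inE.
  apply/existsP/mem_partners => [[w /eqP gw]|[w _ gw]]; exists w => //.
    by have := dir _ _ gw; case: (b); lia.
  exact/eqP.
- by apply/eqP/setP => v; have /and3P[/eqP <- _ _] := H v; rewrite inE.
- apply/matchingP; split=> // v w x gv gw.
  have half (a c : 'I_n) : g a = Some x -> g c = Some x -> a < c -> False.
    move=> ga gc ac; have := H a; rewrite /local_valid ga => /and3P[_ /and3P[_ + _] _].
    by case/mem_partners; exists c.
  by apply/val_inj; case: (ltngtP v w) => // [/half|/half] [].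
apply/forallP => v; apply/implyP; have := H v; rewrite /local_valid.
by case: (g v) => // x /and3P[_ /and3P[]].
Qed.

Lemma layer_count :
  \sum_g [&& layer_openers g == L, layer_closers g == R, matching b g &
            tab_bounded b j k g] =
  tab_count b (mem_nat L) (mem_nat R) j k n (nseq n 0).
Proof.
rewrite -[nseq n 0]/(tableau n [::]) (@tab_count_valid n) //.
rewrite [RHS](reindex (fun g : layer => [tuple g (rev_ord i) | i < n])) /=.
  apply: eq_bigr => g _; rewrite -valid_layer downsE -!map_comp.
  by congr (nat_of_bool (valid _ _ _ _ _ _ _ _)).
exists (fun t : n.-tuple (option 'I_n) => [ffun v => tnth t (rev_ord v)]).
  by move=> g _; apply/ffunP => v; rewrite ffunE tnth_mktuple rev_ordK.
by move=> t _; apply: eq_from_tnth => i; rewrite tnth_mktuple ffunE rev_ordK.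
Qed.

End Valid.

(** Both sides count the closed walks from the empty diagram with the steps
prescribed by L and R, in rectangles that are transposes of each other. *)
Lemma layer_count_sym b L R j k : 0 < j -> 0 < k ->
  \sum_g [&& layer_openers g == L, layer_closers g == R, matching b g &
            tab_bounded b j k g] =
  \sum_g [&& layer_openers g == L, layer_closers g == R, matching b g &
            tab_bounded b k j g].
Proof. by move=> j0 k0; rewrite !layer_count tab_count_sym. Qed.

End Layer.

(** * Arcs and monotone subsequences *)

Lemma subseq_pmap (aT rT : eqType) (f : aT -> option rT) s l :
  subseq s l -> subseq (pmap f s) (pmap f l).
Proof.
case/subseqP => m _ ->; elim: l m => [|x l IH] [|c m] //=; first exact: sub0seq.
case: c => /=; case: (f x) => [y|] //=; first by rewrite eqxx.
exact: subseq_trans (IH m) (subseq_cons _ _).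
Qed.

Lemma subseq_pmapP (aT rT : eqType) (f : aT -> option rT) s l :
  subseq s (pmap f l) ->
  exists2 l', subseq l' l & map f l' = map Some s.
Proof.
case/subseqP => m _ ->; exists (mask m [seq x <- l | f x]).
  exact: subseq_trans (mask_subseq _ _) (filter_subseq _ _).
by rewrite !map_mask pmapS_filter.
Qed.

Lemma path_gtnE m s :
  path gtn m s = sorted gtn s && (nilp s || (head 0 s < m)).
Proof. by case: s => //= x s; rewrite andbC. Qed.

Lemma subseq_mapP (aT rT : eqType) (f : aT -> rT) s l :
  subseq s (map f l) -> exists2 l', subseq l' l & s = map f l'.
Proof.
case/subseqP => m _ ->; exists (mask m l); first exact: mask_subseq.
by rewrite map_mask.
Qed.

Lemma head_rev (T : Type) (x0 : T) s : head x0 (rev s) = last x0 s.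
Proof. by case/lastP: s => // s x; rewrite rev_rcons last_rcons. Qed.

Lemma last_rev (T : Type) (x0 : T) s : last x0 (rev s) = head x0 s.
Proof. by rewrite -head_rev revK. Qed.

Section Arcs.
Variable n : nat.
Notation layer := {ffun 'I_n -> option 'I_n}.
Implicit Types (g : layer) (t d : seq (Defs.arc n)).

Definition in_layer (b : bool) g (a : Defs.arc n) : bool :=
  (a.1 == b) && (g a.2.2 == Some a.2.1).

Definition crossing (b : bool) t :=
  if b then is_enhanced_crossing t else is_crossing t.
Definition nesting (b : bool) t :=
  if b then is_enhanced_nesting t else is_nesting t.

Lemma crossingE (b : bool) t : crossing b t =
  [&& sorted ltn (map (@arc_left n) t),
      last 0 (map (@arc_left n) t) < head 0 (map (@arc_right n) t) + b &
      sorted ltn (map (@arc_right n) t)].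
Proof. by case: b => /=; rewrite ?addn1 ?addn0. Qed.

Lemma nestingE (b : bool) t : nesting b t =
  [&& sorted ltn (map (@arc_left n) t),
      last 0 (map (@arc_left n) t) < head 0 (rev (map (@arc_right n) t)) + b &
      sorted ltn (rev (map (@arc_right n) t))].
Proof. by case: b => /=; rewrite ?addn1 ?addn0. Qed.

(** The arcs are listed by decreasing right endpoint, the order in which their left
endpoints enter the word of partners. *)
Lemma chain_arcs b g m s : subseq s (partners g m) ->
  exists d, [/\ all (in_layer b g) d, map (@arc_left n) d = s,
    sorted gtn (map (@arc_right n) d) & all (leq m) (map (@arc_right n) d)].
Proof.
case/subseq_mapP => s' /subseq_pmapP[l ll gl] ->.
exists [seq (b, (odflt w (g w), w)) | w <- l].
rewrite -!map_comp; split.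
- elim: l s' gl {ll} => [|w l IH] [|x s0] //= [gw /IH->].
  by rewrite /in_layer /= eqxx gw eqxx.
- by elim: l s' gl {ll} => [|w l IH] [|x s0] //= [gw /IH->]; rewrite /= gw.
- by rewrite sorted_map; exact: (subseq_sorted (@vgt_trans n) ll (above_sorted n m)).
- apply/allP => _ /mapP[w wl ->] /=.
  by have := mem_subseq ll wl; rewrite mem_filter => /andP[].
Qed.

Lemma arcs_chain b g m d : all (in_layer b g) d ->
  sorted gtn (map (@arc_right n) d) -> all (leq m) (map (@arc_right n) d) ->
  subseq (map (@arc_left n) d) (partners g m).
Proof.
move=> ld sd md.
have -> : map (@arc_left n) d = map val (pmap g [seq a.2.2 | a <- d]).
  elim: d ld {sd md} => //= a d IH /andP[/andP[_ /eqP ga] /IH->].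
  by rewrite ga.
apply/map_subseq/subseq_pmap/vgt_subseq.
- by move: sd; rewrite !sorted_map; apply: sub_sorted.
- exact: above_sorted.
- move=> _ /mapP[a ad ->]; rewrite mem_filter mem_downs andbT.
  by apply: (allP md); apply: map_f.
Qed.

(** A decreasing subsequence of the partners of the vertices from v on with all
letters below v + b consists of the left endpoints of a crossing, because these
arcs end at v or later; conversely a crossing is seen at its leftmost right
endpoint.  Nestings correspond in the same way to increasing subsequences; only
their arcs are already listed by decreasing right endpoint. *)
Lemma tab_bounded_arcs b g j k : 0 < j -> 0 < k -> matching b g ->
  tab_bounded b j k g <->
  (forall t, all (in_layer b g) t -> crossing b t -> size t < j) /\
  (forall t, all (in_layer b g) t -> nesting b t -> size t < k).
Proof.
move=> j0 k0 mg.
have rows m i s : subseq s (partners g m) -> path gtn i s ->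
    (forall c, c \in tableau i (partners g m) -> c < j) -> size s < j.
  case: s => // x s sp ps; apply.
  apply/schensted_rows; first exact: fresh_uniq (partners_uniq _ mg).
  by exists (x :: s).
have columns m i s : subseq s (partners g m) -> path gtn i (rev s) ->
    count_mem 1 (tableau i (partners g m)) < k -> size s < k.
  move=> sp ps; apply: leq_ltn_trans.
  apply/schensted_columns; first exact: fresh_uniq (partners_uniq _ mg).
  by exists s.
split=> [/forallP tb|[cr ne]].
  split=> -[//|a t] lt.
    rewrite crossingE => /and3P[sI lI sJ].
    (* The first arc of a crossing has the leftmost right endpoint. *)
    have := tb a.2.2; have /andP[/andP[_ /eqP ga] _] := lt; rewrite ga /=.
    case/andP => /allP bj _.
    have <- : size (rev (map (@arc_left n) (a :: t))) = (size t).+1.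
      by rewrite size_rev size_map.
    apply: (rows a.2.2 (a.2.2 + b) _ _ _ bj); last first.
      rewrite path_gtnE rev_sorted sI /=; apply/orP; right.
      by rewrite head_rev.
    rewrite -map_rev; apply: (@arcs_chain b); rewrite ?all_rev // map_rev.
      by rewrite rev_sorted.
    rewrite all_rev /= leqnn /=; move: sJ => /= /(order_path_min ltn_trans).
    by apply: sub_all => x /ltnW.
  rewrite nestingE => /and3P[sI lI sJ].
  (* In a nesting the last arc has the leftmost right endpoint. *)
  set z := last a t; have zt : z \in a :: t by apply: mem_last.
  have := tb z.2.2; have /andP[_ /eqP gz] := allP lt _ zt; rewrite gz /=.
  case/andP => _ ck; have <- : size (map (@arc_left n) (a :: t)) = (size t).+1.
    by rewrite size_map.
  have hJ : head 0 (rev (map (@arc_right n) (a :: t))) = z.2.2.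
    by rewrite head_rev /= last_map.
  apply: columns ck; last first.
    rewrite path_gtnE rev_sorted sI /=; apply/orP; right.
    by rewrite -hJ head_rev.
  apply: (@arcs_chain b) => //; first by rewrite -rev_sorted.
  rewrite -all_rev -hJ; move: sJ; case: (rev _) => //= x s.
  rewrite leqnn /= => /(order_path_min ltn_trans).
  by apply: sub_all => y /ltnW.
apply/forallP => v; apply/implyP => gv; apply/andP; split.
  apply/allP => -[//|c] /schensted_rows[|s [sp ps ss]].
    exact: fresh_uniq (partners_uniq _ mg).
  have [d [ld ds sd md]] := chain_arcs b sp.
  rewrite -ss -ds size_map -size_rev; apply: cr; first by rewrite all_rev.
  move: ps; rewrite path_gtnE -ds => /andP[s1 h1].
  rewrite crossingE !map_rev !rev_sorted s1 sd andbT /= last_rev head_rev.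
  case: d ds {ld sd s1} md h1 => [ds|a d _ md] /=; first by rewrite -ds in ss.
  move/leq_trans; apply; rewrite leq_add2r.
  by apply: (allP md); apply: mem_last.
rewrite ltnNge; apply/negP => /schensted_columns[|s [sp ps ss]].
  exact: fresh_uniq (partners_uniq _ mg).
have [d [ld ds sd md]] := chain_arcs b sp.
suff : size d < k by rewrite -ss -ds size_map ltnn.
apply: ne => //; move: ps; rewrite path_gtnE -ds rev_sorted head_rev.
move=> /andP[s1 h1]; rewrite nestingE rev_sorted s1 sd andbT /= head_rev.
case: d ds {ld sd s1} md h1 => [ds|a d _ md].
  by move: k0; rewrite -ss -ds.
rewrite /nilp size_rev /= => /leq_trans; apply; rewrite leq_add2r.
by apply: (allP md); apply: mem_last.
Qed.

End Arcs.

(** * Layers of a coloured permutation *)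

Section Families.
Variables (n r : nat).
Notation layer := {ffun 'I_n -> option 'I_n}.
Notation index := (bool * 'I_r)%type.
Implicit Types (S : coloured_perm n r) (s : 'S_n) (l : index)
  (h : {ffun index -> layer}).

Lemma mem_arc_of s w : arc_of s w \in Arcs s.
Proof. exact: imset_f. Qed.

Definition arc_colour S (w : 'I_n) : 'I_r :=
  colour (exist (fun a => a \in Arcs (uncoloured S)) _ (mem_arc_of _ w) : permArc S).

(** The layer of colour c formed by the upper (b = true) or lower (b = false)
arcs; its index is the pair (b, c). *)
Definition layer_of S : {ffun index -> layer} :=
  [ffun l : index => [ffun v => [pick x | [exists w,
    (arc_of (uncoloured S) w == (l.1, (x, v))) && (arc_colour S w == l.2)]]]].

Lemma arc_ofE s w b x v : arc_of s w = (b, (x, v)) <->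
  if b then [/\ w = x, s x = v & x <= v] else [/\ w = v, s v = x & x < v].
Proof.
rewrite /arc_of; split.
  by case: (leqP w (s w)) => ws [<- <- <-].
by case: b => -[-> <- le]; rewrite ?le // leqNgt le.
Qed.

Lemma arc_ofEx s w w' b x v v' x' :
  arc_of s w = (b, (x, v)) -> arc_of s w' = (b, (x', v')) ->
  (x = x' <-> v = v') /\ (x = x' -> w = w').
Proof.
move=> /arc_ofE + /arc_ofE; case: b => -[-> <- _] [-> <- _].
  by split=> //; split=> [->|/perm_inj].
by split=> [|/perm_inj//]; split=> [/perm_inj|->].
Qed.

Lemma layer_ofP S l v x : layer_of S l v = Some x <->
  exists2 w, arc_of (uncoloured S) w = (l.1, (x, v)) & arc_colour S w = l.2.
Proof.
rewrite !ffunE; case: pickP => [y /existsP[w /andP[/eqP aw /eqP cw]]|H].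
  split=> [[<-]|[w' aw' _]]; first by exists w.
  have [e _] := arc_ofEx aw aw'; congr Some; exact/e.
split=> // -[w aw cw]; have /existsP[] := negbT (H x).
by exists w; rewrite aw cw !eqxx.
Qed.

Lemma layer_of_inj : injective layer_of.
Proof.
move=> S S' eS.
have e w : arc_of (uncoloured S) w = arc_of (uncoloured S') w /\
           arc_colour S w = arc_colour S' w.
  case a: (arc_of (uncoloured S) w) => [b [x v]].
  have : layer_of S (b, arc_colour S w) v = Some x by apply/layer_ofP; exists w.
  rewrite eS => /layer_ofP[w' /= a' c'].
  have ww : w = w'.
    by case: b a a' => /arc_ofE[-> _ _] /arc_ofE[-> _ _].
  by rewrite -a' -c' ww.
case: S S' {eS} e => [s f] [s' f'] /= e.
have ss : s = s'.
  apply/permP => w; have [+ _] := e w; rewrite /uncoloured /=.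
  case A: (arc_of s w) => [b [x v]] /esym A'.
  by case: b A A' => /arc_ofE[-> -> _] /arc_ofE[_ -> _].
rewrite -{s'}ss in f' e *; congr (existT _ _ _); apply/ffunP => -[a aS].
have /imsetP[w _ aw] := aS; rewrite aw in aS *.
have [_] := e w; rewrite /arc_colour /colour /=.
by rewrite !(bool_irrelevance (mem_arc_of _ _) aS).
Qed.

Lemma matching_layer_of S l : matching l.1 (layer_of S l).
Proof.
apply/matchingP; split=> [v x /layer_ofP[w /arc_ofE + _]|v w x].
  by case: (l.1) => -[_ _] /=; rewrite ?addn1 ?addn0.
move=> /layer_ofP[w1 a1 _] /layer_ofP[w2 a2 _].
by have [e _] := arc_ofEx a1 a2; apply/e.
Qed.

Lemma in_layerP S l (a : permArc S) :
  in_layer l.1 (layer_of S l) (val a) = ((val a).1 == l.1) && (colour a == l.2).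
Proof.
case: a => -[b [x v]] aS; rewrite /in_layer /=.
case: (b =P l.1) => //= bl; apply/eqP/eqP.
  case/layer_ofP => w aw <-; rewrite /arc_colour -bl in aw *.
  by congr (colour _); apply: val_inj.
move=> cl; apply/layer_ofP; have /imsetP[w _ aw] := aS; exists w.
  by rewrite -aw bl.
by rewrite -cl /arc_colour; congr (colour _); apply: val_inj.
Qed.

Lemma lift_arcs S l (u : seq (Defs.arc n)) : all (in_layer l.1 (layer_of S l)) u ->
  exists t : seq (permArc S), map val t = u.
Proof.
elim: u => [|a u IH] /=; first by exists [::].
move=> /andP[la /IH[t <-]].
suff aS : a \in Arcs (uncoloured S) by exists ((exist (fun a => a \in Arcs (uncoloured S)) a aS : permArc S) :: t).
case: a la => b [x v] /andP[/= /eqP-> /eqP/layer_ofP[w <- _]].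
exact: mem_arc_of.
Qed.

(** Crossings and nestings are treated together, as lists of arcs on one side, of
one colour and with a property P that depends on the side.  The empty list is
monochromatic only if there is a colour. *)
Lemma layer_arcsP S m (P : bool -> seq (Defs.arc n) -> bool) : 0 < r ->
  [exists t : m.-tuple (permArc S), let u := map val t in
     monochromatic t && (all_upper u && P true u || all_lower u && P false u)]
  <-> exists l t, [/\ size t = m, all (in_layer l.1 (layer_of S l)) t & P l.1 t].
Proof.
move=> r0; split.
  case/existsP => t /= /andP[/existsP[c /allP ct] H].
  have layered b : all (fun a => a.1 == b) (map val t) ->
      all (in_layer b (layer_of S (b, c))) (map val t).
    move=> /allP tb; apply/allP => _ /mapP[a at_ ->].
    by rewrite (in_layerP (b, c)) /= ct // andbT; apply: tb; apply: map_f.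
  case/orP: H => /andP[ut Pt].
    exists (true, c), (map val t); split=> //; first by rewrite size_map size_tuple.
    by apply: layered; apply: sub_all ut => -[[] p].
  exists (false, c), (map val t); split=> //; first by rewrite size_map size_tuple.
  by apply: layered; apply: sub_all ut => -[[] p].
case=> -[b c] [u [su lu Pu]]; have [t tu] := lift_arcs lu.
have st : size t == m by rewrite -(size_map val) tu su.
apply/existsP; exists (Tuple st) => /=; rewrite tu; apply/andP; split.
  apply/existsP; exists c; apply/allP => a at_.
  have := allP lu (val a); rewrite -tu map_f // => /(_ isT).
  by rewrite in_layerP => /andP[].
have ub : all (fun a => a.1 == b) u by apply: sub_all lu => a /andP[].
rewrite /= in Pu; case: b {lu} Pu ub => -> ub; rewrite !andbT.
  by apply/orP; left; apply: sub_all ub => -[[] p].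
by apply/orP; right; apply: sub_all ub => -[[] p].
Qed.

Lemma has_crossing_layer S m : 0 < r -> has_crossing S m <->
  exists l t, [/\ size t = m, all (in_layer l.1 (layer_of S l)) t &
                crossing l.1 t].
Proof. exact: layer_arcsP. Qed.

Lemma has_nesting_layer S m : 0 < r -> has_nesting S m <->
  exists l t, [/\ size t = m, all (in_layer l.1 (layer_of S l)) t &
                nesting l.1 t].
Proof. exact: layer_arcsP. Qed.

Lemma max_ltP (P : pred nat) j : 0 < j -> (forall m, P m -> m <= n) ->
  (\max_(m < n.+1 | P m) m < j) <-> (forall m, P m -> m < j).
Proof.
case: j => // j _ Pn; rewrite ltnS; split=> [/bigmax_leqP H m Pm|H].
  have mn : m < n.+1 by rewrite ltnS Pn.
  by rewrite ltnS; apply: (H (Ordinal mn)).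
by apply/bigmax_leqP => i /H; rewrite ltnS.
Qed.

Lemma cr_ne_layers S j k : 0 < r -> 0 < j -> 0 < k ->
  (cr S < j) && (ne S < k) = [forall l : index, tab_bounded l.1 j k (layer_of S l)].
Proof.
move=> r0 j0 k0; apply/andP/forallP => [[]|H].
  move=> /(max_ltP j0 (@has_crossing_leq _ _ S)) Hc.
  move=> /(max_ltP k0 (@has_nesting_leq _ _ S)) Hn l.
  apply/tab_bounded_arcs => //; first exact: matching_layer_of.
  split=> t lt ct.
    by apply: Hc; apply/has_crossing_layer => //; exists l, t.
  by apply: Hn; apply/has_nesting_layer => //; exists l, t.
have {}H l := (tab_bounded_arcs j0 k0 (matching_layer_of S l)).1 (H l).
split.
  apply/(max_ltP j0 (@has_crossing_leq _ _ S)) => m /(has_crossing_layer _ _ r0).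
  by case=> l [t [<- lt ct]]; apply: (H l).1.
apply/(max_ltP k0 (@has_nesting_leq _ _ S)) => m /(has_nesting_layer _ _ r0).
by case=> l [t [<- lt ct]]; apply: (H l).2.
Qed.

End Families.

(** * Recombining the layers *)

Section Count.
Variables (n r : nat).
Notation layer := {ffun 'I_n -> option 'I_n}.
Notation index := (bool * 'I_r)%type.
Notation ends := {ffun index -> {set 'I_n} * {set 'I_n}}.
Implicit Types (S : coloured_perm n r) (s : 'S_n) (l : index)
  (h : {ffun index -> layer}) (T : ends).

Definition ends_of h : ends :=
  [ffun l => (layer_openers (h l), layer_closers (h l))].

(** Each vertex v has one arc towards sigma(v), an upper arc starting at v or a
lower arc ending at v, and likewise one arc from the inverse image of v. *)
Definition out_layers T (v : 'I_n) : {set index} :=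
  [set l : index | v \in if l.1 then (T l).1 else (T l).2].
Definition in_layers T (v : 'I_n) : {set index} :=
  [set l : index | v \in if l.1 then (T l).2 else (T l).1].

Definition perm_ends T : bool :=
  [forall v, (#|out_layers T v| == 1) && (#|in_layers T v| == 1)].

(** A loop starts and ends on the upper side, so v is an opener when its outgoing
arc is upper and its incoming arc is lower. *)
Definition opener_ends T : {set 'I_n} :=
  [set v | [exists l : index, (l \in out_layers T v) && l.1] &&
           [exists l : index, (l \in in_layers T v) && ~~ l.1]].
Definition closer_ends T : {set 'I_n} :=
  [set v | [exists l : index, (l \in out_layers T v) && ~~ l.1] &&
           [exists l : index, (l \in in_layers T v) && l.1]].

(** The layer l contains the arc that a permutation sending v to w would have. *)
Definition hop h l (v w : 'I_n) : bool :=
  if l.1 then h l w == Some v else h l v == Some w.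

Lemma out_layersP h l v :
  reflect (exists w, hop h l v w) (l \in out_layers (ends_of h) v).
Proof.
rewrite inE ffunE /hop; case: (l.1) => /=; rewrite inE; first exact: existsP.
case: (h l v) => [w|] /=; constructor; first by exists w.
by case.
Qed.

Lemma in_layersP h l w :
  reflect (exists v, hop h l v w) (l \in in_layers (ends_of h) w).
Proof.
rewrite inE ffunE /hop; case: (l.1) => /=; rewrite inE; last exact: existsP.
case: (h l w) => [v|] /=; constructor; first by exists v.
by case.
Qed.

Lemma hop_layer_of S l v w : hop (layer_of S) l v w =
  [&& w == uncoloured S v, l.1 == (v <= w) & l.2 == arc_colour S v].
Proof.
have -> : hop (layer_of S) l v w =
    (layer_of S l (if l.1 then w else v) == Some (if l.1 then v else w)).
  by rewrite /hop; case: (l.1).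
apply/eqP/and3P.
  case/layer_ofP => z /arc_ofE + <-; case: (l.1) => -[-> ev le].
    by rewrite ev le !eqxx.
  by rewrite ev leqNgt le !eqxx.
case=> /eqP ew lvw /eqP lc; apply/layer_ofP; exists v => //.
apply/arc_ofE; case: (l.1) lvw => /eqP/esym le; first by split.
by split=> //; rewrite ltnNge le.
Qed.

Lemma out_layers_layer_of S v : out_layers (ends_of (layer_of S)) v =
  [set (v <= uncoloured S v, arc_colour S v)].
Proof.
apply/setP => l; rewrite in_set1; apply/out_layersP/eqP => [[w]|->].
  by rewrite hop_layer_of => /and3P[/eqP-> /eqP e1 /eqP e2]; case: l e1 e2 => /= ? ? -> ->.
by exists (uncoloured S v); rewrite hop_layer_of !eqxx.
Qed.

Lemma in_layers_layer_of S w : in_layers (ends_of (layer_of S)) w =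
  let v := (uncoloured S)^-1%g w in [set (v <= w, arc_colour S v)].
Proof.
apply/setP => l; rewrite /= in_set1; apply/in_layersP/eqP => [[v]|->].
  rewrite hop_layer_of => /and3P[/eqP-> /eqP e1 /eqP e2].
  by rewrite permK; case: l e1 e2 => /= ? ? -> ->.
by exists ((uncoloured S)^-1%g w); rewrite hop_layer_of permKV !eqxx.
Qed.

Lemma exists_set1 (T : finType) (P : pred T) x :
  [exists y, (y \in [set x]) && P y] = P x.
Proof.
apply/existsP/idP => [[y /andP[/set1P->]]//|Px].
by exists x; rewrite set11.
Qed.

Lemma perm_ends_layer_of S : perm_ends (ends_of (layer_of S)).
Proof.
by apply/forallP => v; rewrite out_layers_layer_of in_layers_layer_of !cards1.
Qed.

Lemma opener_ends_layer_of S :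
  opener_ends (ends_of (layer_of S)) = openers (uncoloured S).
Proof.
apply/setP => v; rewrite !inE out_layers_layer_of in_layers_layer_of.
rewrite (exists_set1 (fun l => l.1)) (exists_set1 (fun l => ~~ l.1)) /= -ltnNge.
apply/andP/andP => -[le lt]; split=> //; last exact: ltnW.
rewrite ltn_neqAle le andbT; apply/eqP => /val_inj e.
have e' : (uncoloured S)^-1%g v = v by rewrite {1}e permK.
by rewrite e' ltnn in lt.
Qed.

Lemma closer_ends_layer_of S :
  closer_ends (ends_of (layer_of S)) = closers (uncoloured S).
Proof.
apply/setP => v; rewrite !inE out_layers_layer_of in_layers_layer_of.
rewrite (exists_set1 (fun l => ~~ l.1)) (exists_set1 (fun l => l.1)) /= -ltnNge.
apply/andP/andP => -[lt le]; split=> //; last exact: ltnW.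
rewrite ltn_neqAle le andbT; apply/eqP => /val_inj e.
have e' : uncoloured S v = v by rewrite -{1}e permKV.
by rewrite e' ltnn in lt.
Qed.

(** If each vertex has one outgoing and one incoming arc over all layers, then
following the outgoing arcs is an injective map, hence a permutation. *)
Lemma layer_of_surj h : 0 < r -> (forall l, matching l.1 (h l)) ->
  perm_ends (ends_of h) -> exists S, layer_of S = h.
Proof.
move=> r0 mh /forallP ph.
have outE v : exists l w, hop h l v w.
  have /andP[/cards1P[l e] _] := ph v.
  have /out_layersP[w hw] : l \in out_layers (ends_of h) v by rewrite e set11.
  by exists l, w.
have out1 l l' v w w' : hop h l v w -> hop h l' v w' -> l = l' /\ w = w'.
  move=> hw hw'; have /andP[/cards1P[l0 e] _] := ph v.
  have /set1P el : l \in [set l0] by rewrite -e; apply/out_layersP; exists w.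
  have /set1P el' : l' \in [set l0] by rewrite -e; apply/out_layersP; exists w'.
  split; first by rewrite el el'.
  rewrite {}el' -{}el in hw'; move: hw hw'; rewrite /hop.
  have [_ inj] := matchingP _ _ (mh l); case: (l.1) => /eqP hw /eqP hw'.
    exact: inj hw hw'.
  by move: hw'; rewrite hw => -[].
have in1 l l' v v' w : hop h l v w -> hop h l' v' w -> v = v'.
  move=> hv hv'; have /andP[_ /cards1P[l0 e]] := ph w.
  have /set1P el : l \in [set l0] by rewrite -e; apply/in_layersP; exists v.
  have /set1P el' : l' \in [set l0] by rewrite -e; apply/in_layersP; exists v'.
  rewrite {}el' -{}el in hv'; move: hv hv'; rewrite /hop.
  have [_ inj] := matchingP _ _ (mh l); case: (l.1) => /eqP hv /eqP hv'.
    by move: hv'; rewrite hv => -[].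
  exact: inj hv hv'.
have hopE v : [exists p : index * 'I_n, hop h p.1 v p.2].
  by have [l [w hw]] := outE v; apply/existsP; exists (l, w).
pose step v := xchoose (existsP (hopE v)).
have stepP v : hop h (step v).1 v (step v).2 := xchooseP (existsP (hopE v)).
have step_inj : injective (fun v => (step v).2).
  move=> v v' e; have := stepP v; rewrite e => hv.
  exact: in1 hv (stepP v').
pose s := perm step_inj.
have hop_step l v w : hop h l v w = (w == s v) && (l == (step v).1).
  apply/idP/andP => [hw|[/eqP-> /eqP->]]; last by rewrite permE.
  by have [-> ->] := out1 _ _ _ _ _ hw (stepP v); rewrite permE !eqxx.
have upper v : (step v).1.1 = (v <= s v).
  have [dir _] := matchingP _ _ (mh (step v).1).
  move: (stepP v) dir; rewrite /hop permE; case: (_.1.1) => /eqP hv dir.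
    by have := dir _ _ hv; rewrite addn1 ltnS => ->.
  by have := dir _ _ hv; rewrite addn0 ltnNge => /negPf.
pose S : coloured_perm n r := existT _ s
  [ffun a : {a : Defs.arc n | a \in Arcs s} =>
     (step (if (val a).1 then (val a).2.1 else (val a).2.2)).1.2].
have col v : arc_colour S v = (step v).1.2.
  rewrite /arc_colour /colour /= ffunE /=.
  by rewrite /arc_of /uncoloured /=; case: (v <= s v).
exists S; apply/ffunP => l; apply/ffunP => v.
have ext (a c : option 'I_n) : (forall x, a = Some x <-> c = Some x) -> a = c.
  case: a c => [x|] [y|] // H; first by apply/H.
    by have [/(_ erefl)] := H x.
  by have [_ /(_ erefl)] := H y.
apply: ext => x.
have e g w w' : hop g l w w' =
    (g l (if l.1 then w' else w) == Some (if l.1 then w else w')).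
  by rewrite /hop; case: (l.1).
have same w w' : hop (layer_of S) l w w' = hop h l w w'.
  rewrite hop_layer_of hop_step; rewrite col.
  rewrite (_ : uncoloured S = s) //; case: (w' =P s w) => // ->.
  by rewrite -(upper w); case: (l) => a c; case: (step w).1.
have := same (if l.1 then x else v) (if l.1 then v else x).
by rewrite !e; case: (l.1) => /= E; split=> /eqP H; apply/eqP; rewrite ?E // -E.
Qed.

(** Conditions imposed layer by layer have a product as indicator, so that sums
over families of layers factor. *)
Lemma prodn_forall (I : finType) (P : pred I) :
  \prod_i P i = [forall i, P i] :> nat.
Proof.
case: (boolP [forall i, P i]) => [/forallP H|]; first by rewrite big1 // => i _; rewrite H.
by rewrite negb_forall => /existsP[i /negPf ni]; rewrite (bigD1 i) //= ni.
Qed.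

Definition good_layer j k l (p : {set 'I_n} * {set 'I_n}) (g : layer) : bool :=
  [&& layer_openers g == p.1, layer_closers g == p.2, matching l.1 g &
      tab_bounded l.1 j k g].

(** Families of layers are grouped by their endpoint sets; within a group the
layers are independent. *)
Lemma NCN_sum j k (O C : {set 'I_n}) : 0 < r -> 0 < j -> 0 < k ->
  NCN r j k O C =
  \sum_(T : ends | [&& perm_ends T, opener_ends T == O & closer_ends T == C])
    \prod_l \sum_g good_layer j k l (T l) g.
Proof.
move=> r0 j0 k0.
pose Q h := [&& perm_ends (ends_of h), opener_ends (ends_of h) == O,
  closer_ends (ends_of h) == C &
  [forall l, matching l.1 (h l) && tab_bounded l.1 j k (h l)]].
have -> : NCN r j k O C = #|[set h | Q h]|.
  rewrite /NCN -(card_imset _ (@layer_of_inj n r)); apply: eq_card => h.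
  rewrite inE; apply/imsetP/idP => [[S + ->]|].
    rewrite inE andbA cr_ne_layers // => /and3P[/forallP bS eO eC].
    rewrite /Q perm_ends_layer_of opener_ends_layer_of closer_ends_layer_of.
    by rewrite eO eC; apply/forallP => l; rewrite matching_layer_of bS.
  case/and4P => ph eO eC /forallP H.
  have [S eS] : exists S, layer_of S = h.
    by apply: layer_of_surj => // l; have /andP[] := H l.
  exists S => //; rewrite inE andbA cr_ne_layers //.
  rewrite -opener_ends_layer_of -closer_ends_layer_of eS eO eC !andbT.
  by apply/forallP => l; have /andP[] := H l.
under [RHS]eq_bigr do rewrite bigA_distr_bigA.
rewrite exchange_big /= -sum1_card big_mkcond; apply: eq_bigr => h _.
under eq_bigr do rewrite prodn_forall.
rewrite inE; have goodE T : [forall l, good_layer j k l (T l) (h l)] =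
    (T == ends_of h) &&
    [forall l, matching l.1 (h l) && tab_bounded l.1 j k (h l)].
  apply/forallP/andP => [H|[/eqP-> /forallP H] l].
    split; last by apply/forallP => l; have /and4P[_ _ -> ->] := H l.
    apply/eqP/ffunP => l; rewrite ffunE.
    by have /and4P[/eqP-> /eqP-> _ _] := H l; case: (T l).
  by rewrite /good_layer ffunE !eqxx; apply: H.
under eq_bigr do rewrite goodE.
rewrite big_mkcond (bigD1 (ends_of h)) //= eqxx big1 ?addn0 => [|T /negPf->].
  rewrite /Q; case: (perm_ends _) => //; case: (_ == O) => //.
  by case: (_ == C) => //=; case: [forall l, _].
by case: ifP.
Qed.

End Count.

Theorem theorem1 (n r : nat) (hn : 0 < n) (hr : 0 < r) (j k : nat)
    (hj : 0 < j) (hk : 0 < k) (O C : {set 'I_n}) :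
  NCN r j k O C = NCN r k j O C.
Proof.
rewrite !NCN_sum //; apply: eq_bigr => T _; apply: eq_bigr => l _.
exact: layer_count_sym.
Qed.
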